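(* Let $K$ be a perfectoid field with pseudouniformizer $\varpi$, let $0\le r\le n$ and let $d$ be a positive integer. Let $R$ be either $$K^\circ\big\langle X_1^{1/p^\infty},\dots,X_r^{1/p^\infty},X_{r+1}^{\pm1/p^\infty},\dots,X_n^{\pm1/p^\infty}\big\rangle$$ or $$K^\circ/\varpi^d\,\big[X_1^{1/p^\infty},\dots,X_r^{1/p^\infty},X_{r+1}^{\pm1/p^\infty},\dots,X_n^{\pm1/p^\infty}\big].$$ Then every finite projective $R$-module is free.
   Context: $K$ is a perfectoid field of residue characteristic $p$ with valuation ring $K^\circ$; a pseudouniformizer is a topologically nilpotent unit of $K$. The ring $K^\circ\langle X_1^{1/p^\infty},\dots,X_r^{1/p^\infty},X_{r+1}^{\pm1/p^\infty},\dots,X_n^{\pm1/p^\infty}\rangle$ is the $\varpi$-adic completion of $\bigcup_m K^\circ[X_1^{1/p^m},\dots,X_r^{1/p^m},X_{r+1}^{\pm1/p^m},\dots,X_n^{\pm1/p^m}]$. For $r=n$ it is the subring $(T_n^{\mathrm{perf}})^\circ$ of power-bounded elements of the perfectoid Tate algebra $K\langle X_1^{1/p^\infty},\dots,X_n^{1/p^\infty}\rangle$. The second ring is the quotient of the first by $\varpi^d$. *)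

(* Defs.v *)
From HB Require Import structures.
From mathcomp Require Import all_boot all_order all_algebra.
From mathcomp Require Import finmap.
From mathcomp Require Import boolp reals.
From mathcomp.multinomials Require Import monalg.

Set Implicit Arguments.
Unset Strict Implicit.
Unset Printing Implicit Defensive.

Import Order.TTheory GRing.Theory Num.Theory.

Local Open Scope ring_scope.
Local Open Scope quotient_scope.

Definition finite_module (R : pzRingType) (M : lmodType R) : Prop :=
  exists (m : nat) (e : 'I_m -> M),
    forall x : M, exists c : 'I_m -> R, x = \sum_(i < m) c i *: e i.

Definition projective_module (R : pzRingType) (M : lmodType R) : Prop :=
  forall (N P : lmodType R) (g : {linear N -> P}) (f : {linear M -> P}),
    (forall y : P, exists x : N, g x = y) ->
    exists h : {linear M -> N}, forall x : M, g (h x) = f x.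

Definition free_module (R : pzRingType) (M : lmodType R) : Prop :=
  exists (I : choiceType) (e : I -> M),
    forall x : M, exists! c : {fsfun I -> R with 0},
      x = \sum_(i <- finsupp c) c i *: e i.

(* MathComp's [{ideal_quot I}] only covers proper ideals; here [a] may be a
   unit, as it is for the zeroth term of the tower [A / a ^ k]. *)
Section PrincipalQuotient.
Variables (A : comPzRingType) (a : A).

Definition principal_ideal : {pred A} :=
  fun x => `[< exists c : A, x = a * c >].

Lemma principal_idealP x :
  reflect (exists c, x = a * c) (x \in principal_ideal).
Proof. exact: asboolP. Qed.

Fact principal_ideal_zmod_closed : zmod_closed principal_ideal.
Proof.
split=> [|x y /principal_idealP[c ->] /principal_idealP[d ->]];
  apply/principal_idealP; first by exists 0; rewrite mulr0.
by exists (c - d); rewrite mulrBr.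
Qed.

HB.instance Definition _ :=
  GRing.isZmodClosed.Build A principal_ideal principal_ideal_zmod_closed.

Definition quot_ring := {ideal_quot principal_ideal}.

HB.instance Definition _ := GRing.Zmodule.on quot_ring.
HB.instance Definition _ :=
  EqQuotient.on quot_ring.

Definition quot_one : quot_ring := \pi_quot_ring 1.
Definition quot_mul (x y : quot_ring) : quot_ring :=
  \pi_quot_ring (repr x * repr y).

Lemma quot_eqP (x y : A) :
  reflect (exists c, x - y = a * c) (\pi_quot_ring x == \pi_quot_ring y).
Proof. by rewrite -Quotient.idealrBE; apply: principal_idealP. Qed.

Lemma quot_piM (x y : A) :
  \pi_quot_ring (x * y) = quot_mul (\pi_quot_ring x) (\pi_quot_ring y).
Proof.
rewrite /quot_mul; apply/eqP/quot_eqP.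
have [c hc] := quot_eqP x (repr (\pi_quot_ring x))
  (introT eqP (esym (reprK (\pi_quot_ring x)))).
have [d hd] := quot_eqP y (repr (\pi_quot_ring y))
  (introT eqP (esym (reprK (\pi_quot_ring y)))).
exists (c * y + repr (\pi_quot_ring x) * d).
by rewrite mulrDr mulrA -hc mulrCA -hd mulrBl mulrBr addrA subrK.
Qed.

Lemma quot_piD (x y : A) :
  \pi_quot_ring (x + y) = \pi_quot_ring x + \pi_quot_ring y :> quot_ring.
Proof. exact: Quotient.pi_add. Qed.

Fact quot_mulA : associative quot_mul.
Proof.
elim/quotW=> x; elim/quotW=> y; elim/quotW=> z.
by rewrite -(quot_piM y) -(quot_piM x y) -!quot_piM mulrA.
Qed.
Fact quot_mulC : commutative quot_mul.
Proof. by move=> x y; rewrite /quot_mul mulrC. Qed.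
Fact quot_mul1 : left_id quot_one quot_mul.
Proof. by elim/quotW=> x; rewrite -quot_piM mul1r. Qed.
Fact quot_mulDl : left_distributive quot_mul +%R.
Proof.
elim/quotW=> x; elim/quotW=> y; elim/quotW=> z.
by rewrite -quot_piD -!quot_piM -quot_piD mulrDl.
Qed.

HB.instance Definition _ := GRing.Zmodule_isComPzRing.Build quot_ring
  quot_mulA quot_mulC quot_mul1 quot_mulDl.

Definition quot_pi (x : A) : quot_ring := \pi_quot_ring x.

Fact quot_pi_zmod : zmod_morphism quot_pi.
Proof.
move=> x y; rewrite /quot_pi quot_piD; congr (_ + _).
exact: Quotient.pi_opp.
Qed.
Fact quot_pi_monoid : monoid_morphism quot_pi.
Proof. by split=> // x y; rewrite /quot_pi quot_piM. Qed.

HB.instance Definition _ :=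
  GRing.isZmodMorphism.Build A quot_ring quot_pi quot_pi_zmod.
HB.instance Definition _ :=
  GRing.isMonoidMorphism.Build A quot_ring quot_pi quot_pi_monoid.

End PrincipalQuotient.

Section CountableProduct.
Variable T : nat -> comPzRingType.

Definition nat_prod := forall k, T k.

HB.instance Definition _ := gen_eqMixin nat_prod.
HB.instance Definition _ := gen_choiceMixin nat_prod.

Let ext (x y : nat_prod) : (forall k, x k = y k) -> x = y.
Proof. exact: functional_extensionality_dep. Qed.

Definition nat_prod0 : nat_prod := fun _ => 0.
Definition nat_prod1 : nat_prod := fun _ => 1.
Definition nat_prodN (x : nat_prod) : nat_prod := fun k => - x k.
Definition nat_prodD (x y : nat_prod) : nat_prod := fun k => x k + y k.
Definition nat_prodM (x y : nat_prod) : nat_prod := fun k => x k * y k.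

Fact nat_prodDA : associative nat_prodD.
Proof. by move=> x y z; apply: ext => k; apply: addrA. Qed.
Fact nat_prodDC : commutative nat_prodD.
Proof. by move=> x y; apply: ext => k; apply: addrC. Qed.
Fact nat_prod0D : left_id nat_prod0 nat_prodD.
Proof. by move=> x; apply: ext => k; apply: add0r. Qed.
Fact nat_prodND : left_inverse nat_prod0 nat_prodN nat_prodD.
Proof. by move=> x; apply: ext => k; apply: addNr. Qed.
Fact nat_prodMA : associative nat_prodM.
Proof. by move=> x y z; apply: ext => k; apply: mulrA. Qed.
Fact nat_prodMC : commutative nat_prodM.
Proof. by move=> x y; apply: ext => k; apply: mulrC. Qed.
Fact nat_prod1M : left_id nat_prod1 nat_prodM.
Proof. by move=> x; apply: ext => k; apply: mul1r. Qed.
Fact nat_prodMDl : left_distributive nat_prodM nat_prodD.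
Proof. by move=> x y z; apply: ext => k; apply: mulrDl. Qed.

HB.instance Definition _ := GRing.isZmodule.Build nat_prod
  nat_prodDA nat_prodDC nat_prod0D nat_prodND.
HB.instance Definition _ := GRing.Zmodule_isComPzRing.Build nat_prod
  nat_prodMA nat_prodMC nat_prod1M nat_prodMDl.

End CountableProduct.

Section AdicCompletion.
Variables (A : comPzRingType) (a : A).

(* The inverse limit of the rings [A / a ^ k]: the transition map sends
   [x k.+1] to [x k] iff the two classes have a common representative. *)
Definition adic_compatible :
    {pred nat_prod (fun k => quot_ring (a ^+ k))} :=
  fun x => `[< forall k, exists b : A,
    quot_pi (a ^+ k) b = x k /\ quot_pi (a ^+ k.+1) b = x k.+1 >].

Fact adic_compatible_subring : subring_closed adic_compatible.
Proof.
split=> [|x y /asboolP hx /asboolP hy|x y /asboolP hx /asboolP hy];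
  apply/asboolP => k.
- by exists 1; rewrite !rmorph1.
- have [[b [b0 b1]] [c [c0 c1]]] := (hx k, hy k).
  by exists (b - c); rewrite !rmorphB /= b0 b1 c0 c1.
- have [[b [b0 b1]] [c [c0 c1]]] := (hx k, hy k).
  by exists (b * c); rewrite !rmorphM /= b0 b1 c0 c1.
Qed.

HB.instance Definition _ := GRing.isSubringClosed.Build _
  adic_compatible adic_compatible_subring.

Record adic_completion := AdicCompletion {
  adic_val :> nat_prod (fun k => quot_ring (a ^+ k));
  adic_valP : adic_val \in adic_compatible }.

HB.instance Definition _ := [isSub for adic_val].
HB.instance Definition _ := [Choice of adic_completion by <:].
HB.instance Definition _ :=
  GRing.SubChoice_isSubComPzRing.Build _ _ adic_completion (subringClosedP _).

End AdicCompletion.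

(* The multinomials library makes [{malg A[E]}] a ring only when the identity
   is the sole invertible element of the monoid [E], which excludes Laurent
   monomials. Here [E] is an arbitrary commutative monoid, written additively. *)
Section MonoidAlgebra.
Variables (A : comPzRingType) (E : nmodType).

Definition monoid_alg := {malg A[E]}.

HB.instance Definition _ := GRing.Zmodule.on monoid_alg.

Implicit Types f g h : monoid_alg.

(* [ma_monom c e] is the term c X^e. *)
Definition ma_monom (c : A) (e : E) : monoid_alg := mkmalgU e c.

Definition ma_mul f g : monoid_alg :=
  \sum_(e1 <- msupp f) \sum_(e2 <- msupp g)
    ma_monom (mcoeff e1 f * mcoeff e2 g) (e1 + e2).

Definition ma_one : monoid_alg := ma_monom 1 0.

Let monom0 e : ma_monom 0 e = 0.
Proof. exact: monalgU0. Qed.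
Let monomD e : {morph ma_monom^~ e : x y / x + y}.
Proof. exact: monalgUD. Qed.

Let mulw (d1 d2 : {fset E}) f g :
  fsubset (msupp f) d1 -> fsubset (msupp g) d2 ->
  ma_mul f g = \sum_(e1 <- d1) \sum_(e2 <- d2)
    ma_monom (mcoeff e1 f * mcoeff e2 g) (e1 + e2).
Proof.
move=> le1 le2; rewrite /ma_mul (big_fset_incl _ le1) /=.
  apply/eq_bigr=> k1 _; apply/big_fset_incl => // k _ /mcoeff_outdom ->.
  by rewrite mulr0 monom0.
move=> k _ /mcoeff_outdom fk.
by rewrite big1 => // k' _; rewrite fk mul0r monom0.
Qed.

Fact ma_mulC : commutative ma_mul.
Proof.
move=> f g; rewrite /ma_mul exchange_big /=; apply/eq_bigr => i _.
by apply/eq_bigr => j _; rewrite mulrC addrC.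
Qed.

Fact ma_mulDl : left_distributive ma_mul +%R.
Proof.
move=> f1 f2 g.
rewrite (mulw (msuppD_le _ _) (fsubset_refl _)).
rewrite (mulw (fsubsetUl _ (msupp f2)) (fsubset_refl _)).
rewrite (mulw (fsubsetUr (msupp f1) _) (fsubset_refl _)).
rewrite -big_split /=; apply/eq_bigr=> k1 _.
rewrite -big_split /=; apply/eq_bigr=> k2 _.
by rewrite mcoeffD mulrDl monomD.
Qed.

Let mulDr : right_distributive ma_mul +%R.
Proof. by move=> f g h; rewrite ma_mulC ma_mulDl !(ma_mulC f). Qed.
Let mul0 : left_zero 0 ma_mul.
Proof. by move=> f; rewrite /ma_mul msupp0 big_seq_fset0. Qed.
Let mulr0' : right_zero 0 ma_mul.
Proof. by move=> f; rewrite ma_mulC mul0. Qed.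

Lemma ma_mulUU c1 c2 e1 e2 :
  ma_mul (ma_monom c1 e1) (ma_monom c2 e2) = ma_monom (c1 * c2) (e1 + e2).
Proof. by rewrite (mulw msuppU_le msuppU_le) !big_seq_fset1 !mcoeffUU. Qed.

Let monE f : f = \sum_(e <- msupp f) ma_monom (mcoeff e f) e.
Proof. exact: monalgE. Qed.

Fact ma_mul1 : left_id ma_one ma_mul.
Proof.
move=> f; rewrite {2}[f]monE [LHS](mulw msuppU_le (fsubset_refl _)).
rewrite big_seq_fset1.
by apply/eq_bigr=> e _; rewrite mcoeffUU mul1r add0r.
Qed.

Fact ma_mulA : associative ma_mul.
Proof.
have suml I (s : seq I) (F : I -> monoid_alg) g :
    ma_mul (\sum_(i <- s) F i) g = \sum_(i <- s) ma_mul (F i) g.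
  exact: (big_morph (ma_mul^~ g) (fun _ _ => ma_mulDl _ _ _) (mul0 g)).
have sumr I (s : seq I) (F : I -> monoid_alg) g :
    ma_mul g (\sum_(i <- s) F i) = \sum_(i <- s) ma_mul g (F i).
  exact: (big_morph (ma_mul g) (fun _ _ => mulDr _ _ _) (mulr0' g)).
move=> f g h; rewrite [f]monE [g]monE.
rewrite !suml; apply/eq_bigr => i _; rewrite !sumr suml.
apply/eq_bigr => j _; rewrite [h]monE !sumr.
by apply/eq_bigr => k _; rewrite !ma_mulUU mulrA addrA.
Qed.

HB.instance Definition _ := GRing.Zmodule_isComPzRing.Build monoid_alg
  ma_mulA ma_mulC ma_mul1 ma_mulDl.

Definition ma_const (c : A) : monoid_alg := ma_monom c 0.

End MonoidAlgebra.

Section PerfectedMonomials.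
Variables (p r n : nat).

(* Exponents of the monomials in X_1, ..., X_r, X_{r+1}^{+-1}, ..., X_n^{+-1}
   and their p-power roots; variables are numbered from 0. *)
Definition perf_exponent : {pred {ffun 'I_n -> rat}} :=
  fun e => `[< (exists m : nat, forall i, (p ^ m)%:R * e i \is a Num.int) /\
               (forall i : 'I_n, (i < r)%N -> 0 <= e i) >].

Fact perf_exponent_addr : addr_closed perf_exponent.
Proof.
split=> [|e f /asboolP[[m he] he0] /asboolP[[k hf] hf0]]; apply/asboolP.
  by split=> [|i _]; [exists 0%N => i|]; rewrite ffunE ?mulr0 ?rpred0.
split=> [|i ir]; last by rewrite ffunE addr_ge0 ?he0 ?hf0.
exists (m + k)%N => i; rewrite ffunE mulrDr expnD natrM.
rewrite rpredD //; first by rewrite mulrAC rpredM ?natr_int ?he.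
by rewrite -mulrA rpredM ?natr_int ?hf.
Qed.

HB.instance Definition _ :=
  GRing.isAddClosed.Build _ perf_exponent perf_exponent_addr.

Record perf_monom := PerfMonom {
  pm_exp :> {ffun 'I_n -> rat};
  pm_expP : pm_exp \in perf_exponent }.

HB.instance Definition _ := [isSub for pm_exp].
HB.instance Definition _ := [Choice of perf_monom by <:].
HB.instance Definition _ :=
  GRing.SubChoice_isSubNmodule.Build _ _ perf_monom perf_exponent_addr.

End PerfectedMonomials.

(* The union over m of A[X_1^{1/p^m}, ..., X_r^{1/p^m},
   X_{r+1}^{+-1/p^m}, ..., X_n^{+-1/p^m}]. *)
Definition perf_poly (A : comPzRingType) (p r n : nat) : comPzRingType :=
  monoid_alg A (perf_monom p r n).

(* A nonarchimedean absolute value encodes a valuation of rank at most one. *)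
Record valuedField (RR : realType) := ValuedField {
  vf_sort :> fieldType;
  absv : vf_sort -> RR;
  absv_ge0 : forall x, 0 <= absv x;
  absv_eq0 : forall x, absv x = 0 <-> x = 0;
  absvM : forall x y, absv (x * y) = absv x * absv y;
  absvD : forall x y, absv (x + y) <= Num.max (absv x) (absv y) }.

Section ValuationRing.
Variables (RR : realType) (K : valuedField RR).

Lemma absv1 : absv (1 : K) = 1.
Proof.
have h : absv (1 : K) != 0 by apply/eqP => /absv_eq0/eqP; rewrite oner_eq0.
by apply: (mulfI h); rewrite -absvM !mulr1.
Qed.

Lemma absvN (x : K) : absv (- x) = absv x.
Proof.
have h : absv (-1 : K) = 1.
  apply/eqP; rewrite -(@eqrXn2 _ 2) ?absv_ge0 //.
  by rewrite expr2 -absvM mulrNN mulr1 absv1 expr1n.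
by rewrite -mulN1r absvM h mul1r.
Qed.

Definition val_integral : {pred K} := fun x => absv x <= 1.

Fact val_integral_subring : subring_closed val_integral.
Proof.
split=> [|x y hx hy|x y hx hy]; rewrite unfold_in /= ?absv1 //.
  by apply: (le_trans (absvD _ _)); rewrite absvN ge_max; apply/andP.
by rewrite absvM mulr_ile1 ?absv_ge0.
Qed.

HB.instance Definition _ :=
  GRing.isSubringClosed.Build K val_integral val_integral_subring.

Record val_ring := ValRing {
  vr_val :> K;
  vr_valP : vr_val \in val_integral }.

HB.instance Definition _ := [isSub for vr_val].
HB.instance Definition _ := [Choice of val_ring by <:].
HB.instance Definition _ := [SubChoice_isSubComNzRing of val_ring by <:].

Definition topologically_nilpotent (x : K) : Prop :=
  forall e : RR, 0 < e -> exists N : nat, forall k, (N <= k)%N ->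
    absv (x ^+ k) < e.

Definition pseudouniformizer (x : K) : Prop :=
  x \is a GRing.unit /\ topologically_nilpotent x.

Definition vf_cauchy (u : nat -> K) : Prop :=
  forall e : RR, 0 < e -> exists N : nat, forall j k, (N <= j)%N -> (N <= k)%N ->
    absv (u j - u k) < e.

Definition vf_converges (u : nat -> K) (l : K) : Prop :=
  forall e : RR, 0 < e -> exists N : nat, forall k, (N <= k)%N ->
    absv (u k - l) < e.

Definition vf_complete : Prop :=
  forall u : nat -> K, vf_cauchy u -> exists l, vf_converges u l.

(* 1 is not isolated in the value group; in particular the absolute value is
   nontrivial, i.e. of rank exactly one. *)
Definition vf_nondiscrete : Prop :=
  forall e : RR, 0 < e -> exists x : K, 1 < absv x < 1 + e.

(* [p%:R] vanishes in the residue field, whose elements are the classes of the integral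
   elements modulo those of absolute value < 1. *)
Definition residue_char (p : nat) : Prop := prime p /\ absv (p%:R : K) < 1.

Definition perfectoid (p : nat) : Prop :=
  [/\ vf_complete, vf_nondiscrete, residue_char p &
      forall y : quot_ring (p%:R : val_ring),
        exists x : quot_ring (p%:R : val_ring), x ^+ p = y].

End ValuationRing.

(* K°<X_1^{1/p^oo}, ...>, with [w] embedded as a constant polynomial. *)
Definition perf_tate_integral (RR : realType) (K : valuedField RR)
    (w : val_ring K) (p r n : nat) : comPzRingType :=
  @adic_completion (perf_poly (val_ring K) p r n) (ma_const _ w).

(* K°/w^d [X_1^{1/p^oo}, ...]. *)
Definition perf_poly_mod (RR : realType) (K : valuedField RR)
    (w : val_ring K) (d p r n : nat) : comPzRingType :=
  perf_poly (quot_ring (w ^+ d)) p r n.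

(* Main.v *)
Require Import Defs.
From HB Require Import structures.
From mathcomp Require Import fingroup perm.
From mathcomp Require Import all_boot all_order all_algebra.
From mathcomp Require Import finmap.
From mathcomp Require Import boolp classical_sets reals.
From mathcomp.multinomials Require Import monalg.
From mathcomp Require Import zify ring lra.

Set Implicit Arguments.
Unset Strict Implicit.
Unset Printing Implicit Defensive.

Import Order.TTheory GRing.Theory Num.Theory.

Local Open Scope ring_scope.

(** A finite projective module is the image of an idempotent matrix [e], and it
    is free exactly when [e = U V] with [V U = 1]; the ring property to prove is
    thus [idem_free], a statement on matrices. It lifts along every surjection
    [R -> S] under which the elements over 1 are invertible
    ([idem_free_lift]). Let [k] be the residue field of the valuation ring. The
    valuation has rank one, so every element of the maximal ideal has a power
    divisible by any given power of [w]; hence both rings of the theorem lift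
    the ring of polynomials, with p-power roots, over [k] ([ma_unit_mod],
    [idem_free_completion]). An idempotent over the latter involves finitely
    many exponents, so it lives over an ordinary ring of polynomials in the
    [X_i^(1/p^m)], some of them inverted ([idem_free_perf]). What remains is the
    theorem of Quillen and Suslin, with Laurent variables allowed
    ([quillen_suslin_laurent]).

    Its proof is an induction on the variables, for all fields [k] at once. Let
    [A] be the algebra of the previous variables and [t] the new one. The
    induction hypothesis over the field [k(t)] shows that a projective module
    over [A[t]] becomes free once a monic [g] in [k[t]] is inverted
    ([generic_splitting]).
    - If [A] is local, Horrocks' theorem says that the module is free. The basis
      over the localization extends the module to a vector bundle on the
      projective line over [A]. It can be changed so that the bundle is trivial
      on the special fibre; then H^1 of the bundle twisted by -1 vanishes, by
      Nakayama, and a basis of the special fibre lifts to a basis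
      ([horrocks_local]).
    - In general, the elements [c] of [A] such that [e(x + c y)] and [e(x)] are
      equivalent form an ideal, for trivial reasons. By the local case it lies
      in no maximal ideal, so that [e(t)] is equivalent to [e(0)]
      ([affine_horrocks]), which is free by induction.
    - A module over [A[t, 1/t]] that becomes free after inverting [g] can be
      glued with a free module to give a module over [A[t]], since [g] can be
      taken prime to [t] ([idem_free_adjoin_int]). *)

(** * Idempotent matrices and their images *)

(** Murray-von Neumann equivalence: for idempotents, the images of [e] and [e']
    are isomorphic. *)
Definition mvn (R : comPzRingType) m n (e : 'M[R]_m) (e' : 'M[R]_n) : Prop :=
  exists (G : 'M_(m, n)) (H : 'M_(n, m)), G *m H = e /\ H *m G = e'.

Definition idem_free (R : comPzRingType) : Prop :=
  forall N (e : 'M[R]_N), e *m e = e -> exists r, mvn e (1%:M : 'M_r).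

Section MvN.
Variable R : comPzRingType.

Lemma mvn_trans m n k (e : 'M[R]_m) (e1 : 'M[R]_n) (e2 : 'M[R]_k) :
  e *m e = e -> e2 *m e2 = e2 -> mvn e e1 -> mvn e1 e2 -> mvn e e2.
Proof.
move=> he he2 [G [H [h1 h2]]] [G' [H' [h3 h4]]]; exists (G *m G'), (H' *m H).
split.
  by rewrite -mulmxA (mulmxA G') h3 -h2 !mulmxA h1 -mulmxA h1.
by rewrite -mulmxA (mulmxA H) h2 -h3 !mulmxA h4 -mulmxA h4.
Qed.

Lemma inv_of_det n (M : 'M[R]_n) y :
  \det M * y = 1 -> exists M', M *m M' = 1%:M /\ M' *m M = 1%:M.
Proof.
move=> h; exists (y *: \adj M).
by rewrite -scalemxAr -scalemxAl mul_mx_adj mul_adj_mx !scale_scalar_mx mulrC h.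
Qed.

End MvN.

Lemma mvn_map (R S : comPzRingType) (f : {rmorphism R -> S}) m n
    (e : 'M[R]_m) (e' : 'M[R]_n) : mvn e e' -> mvn (map_mx f e) (map_mx f e').
Proof.
move=> [G [H [h1 h2]]]; exists (map_mx f G), (map_mx f H).
by rewrite -!map_mxM h1 h2.
Qed.

Lemma surj_mx (A B : Type) (f : A -> B) :
  (forall y, exists x, f x = y) ->
  forall m n (M : 'M[B]_(m, n)), exists M', map_mx f M' = M.
Proof.
move=> hf m n M; have [g hg] := choice hf.
by exists (map_mx g M); apply/matrixP => i j; rewrite !mxE hg.
Qed.

Lemma map_mx_inj' (A B : Type) (f : A -> B) m n :
  injective f -> injective (@map_mx _ _ f m n).
Proof.
move=> hf M M' /matrixP h; apply/matrixP => i j; apply: hf.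
by have := h i j; rewrite !mxE.
Qed.

Section Lift.
Variables (R S : comPzRingType) (f : {rmorphism R -> S}).

Lemma mvn_bij N r (e : 'M[R]_N) : injective f -> (forall y, exists x, f x = y) ->
  mvn (map_mx f e) (1%:M : 'M_r) -> mvn e (1%:M : 'M_r).
Proof.
move=> fi fs [G [H [h1 h2]]].
have [G' hG] := surj_mx fs G; have [H' hH] := surj_mx fs H.
exists G', H'; split; apply: (map_mx_inj' fi); rewrite map_mxM hG hH //.
by rewrite h2 map_mx1.
Qed.

Lemma idem_free_bij : injective f -> (forall y, exists x, f x = y) ->
  idem_free S -> idem_free R.
Proof.
move=> fi fs hS N e he.
have [|r h] := hS N (map_mx f e); first by rewrite -map_mxM he.
by exists r; apply: mvn_bij h.
Qed.

Hypothesis fs : forall y, exists x, f x = y.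
Hypothesis funit : forall x, f x = 1 -> exists y, x * y = 1.

Lemma inv_of_map1 n (M : 'M[R]_n) : map_mx f M = 1%:M ->
  exists M', M *m M' = 1%:M /\ M' *m M = 1%:M.
Proof.
move=> h; have [|y hy] := funit (x := \det M); last exact: inv_of_det hy.
by rewrite -det_map_mx h det1.
Qed.

(** The lifted factors split off a summand of the image of [e] of the right rank.
    The complement is the image of an idempotent [h] that vanishes under [f];
    then [1 - h] is invertible and [h (1 - h) = 0] gives [h = 0]. *)
Lemma idem_free_lift : idem_free S -> idem_free R.
Proof.
move=> hS N e he; have he' : map_mx f e *m map_mx f e = map_mx f e.
  by rewrite -map_mxM he.
have [r [U0 [V0 [h1 h2]]]] := hS _ _ he'.
have [U1 hU] := surj_mx fs U0; have [V1 hV] := surj_mx fs V0.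
pose U := e *m U1; pose V := V1 *m e.
have eU : e *m U = U by rewrite mulmxA he.
have eV : V *m e = V by rewrite -mulmxA he.
have mU : map_mx f U = U0 by rewrite map_mxM hU -h1 -mulmxA h2 mulmx1.
have mV : map_mx f V = V0 by rewrite map_mxM hV -h1 mulmxA h2 mul1mx.
clearbody U V.
have [|Z [hZ1 hZ2]] := @inv_of_map1 _ (V *m U); first by rewrite map_mxM mU mV.
have mZ : map_mx f Z = 1%:M.
  by have := congr1 (map_mx f) hZ1; rewrite !map_mxM mU mV h2 mul1mx map_mx1.
exists r, U, (Z *m V); split; last by rewrite -mulmxA.
pose e' := U *m (Z *m V); rewrite -/e'.
have ee' : e *m e' = e' by rewrite /e' mulmxA eU.
have e'e : e' *m e = e' by rewrite /e' -!mulmxA eV.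
have e'e' : e' *m e' = e'.
  by rewrite /e' -!mulmxA (mulmxA V) (mulmxA Z (V *m U)) hZ2 mul1mx.
pose h := e - e'.
have hh : h *m h = h.
  by rewrite /h mulmxBl !mulmxBr he ee' e'e e'e' subrr subr0.
have mh : map_mx f (1%:M - h) = 1%:M.
  rewrite map_mxB map_mx1 /h map_mxB /e' !map_mxM mU mV mZ mul1mx h1.
  by rewrite subrr subr0.
have [W [hW _]] := inv_of_map1 mh.
apply/eqP; rewrite -subr_eq0 -opprB oppr_eq0 -/h; apply/eqP.
by rewrite -[h]mulmx1 -hW mulmxA mulmxBr mulmx1 hh subrr mul0mx.
Qed.

End Lift.

Lemma idem_free_field (k : fieldType) : idem_free k.
Proof.
move=> N e he; exists (\rank e), (col_base e), (row_base e).
have CB := mulmx_base e.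
have : row_free (col_base e)^T.
  by rewrite /row_free mxrank_tr; have := col_base_full e; rewrite /row_full.
move: CB (row_base_free e); move: (col_base e) (row_base e) => C B CB fB fC.
split=> //; apply: (row_free_inj fB); rewrite mul1mx.
apply: trmx_inj; apply: (row_free_inj fC); rewrite -!trmx_mul.
by rewrite !mulmxA CB -mulmxA CB he.
Qed.

(** A presentation [g] of [M] has a section [h], and [h \o g] is an idempotent
    matrix whose row space is a copy of [M]; the rows of [V] are then a basis. *)
Lemma idem_free_module (R : comPzRingType) : idem_free R ->
  forall M : lmodType R, finite_module M -> projective_module M ->
  free_module M.
Proof.
move=> hR M [m [b hb]] hp.
pose g0 (x : 'rV[R]_m) : M := \sum_i x 0 i *: b i.
have g0_lin : linear g0.
  move=> a x y; rewrite /g0 scaler_sumr -big_split /=; apply: eq_bigr => i _.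
  by rewrite !mxE scalerDl scalerA.
pose gL := GRing.isLinear.Build R _ _ _ g0 g0_lin.
pose g : {linear 'rV[R]_m -> M} := HB.pack g0 gL.
have gs : forall y, exists x, g x = y.
  move=> y; have [c ->] := hb y; exists (\row_i c i) => /=.
  by apply: eq_bigr => i _; rewrite mxE.
clearbody g; clear hb gL g0_lin g0.
have [h gh] := hp 'rV[R]_m M g idfun gs; pose e := lin1_mx (h \o g).
have eE x : x *m e = h (g x) by rewrite mul_rV_lin1.
have he : e *m e = e.
  by apply/row_matrixP => i; rewrite row_mul eE rowE eE gh.
have [r [U [V [hUV hVU]]]] := hR _ e he.
exists 'I_r, (fun j => g (row j V)) => x.
have sumE (c : {fsfun 'I_r -> R with 0}) :
    \sum_(i <- finsupp c) c i *: g (row i V) = g ((\row_i c i) *m V).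
  rewrite mulmx_sum_row linear_sum /= big_uniq ?fset_uniq //= big_mkcond /=.
  apply: eq_bigr => i _; rewrite linearZ /= mxE; case: ifP => // /negbT.
  by rewrite memNfinsupp => /eqP ->; rewrite scale0r.
have Ve : V *m e = V by rewrite -hUV mulmxA hVU mul1mx.
have cV (c : 'rV[R]_r) : h (g (c *m V)) *m U = c.
  by rewrite -eE -!mulmxA (mulmxA V) Ve hVU mulmx1.
pose c0 : {fsfun 'I_r -> R with 0} :=
  [fsfun i in [fset j : 'I_r | true]%fset => (h x *m U) 0 i | 0].
have c0E i : c0 i = (h x *m U) 0 i by rewrite fsfunE !inE.
exists c0; split.
  have -> : \sum_(i <- finsupp c0) c0 i *: g (row i V) = g (h x *m U *m V).
    by rewrite sumE; congr (g (_ *m _)); apply/rowP => i; rewrite mxE c0E.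
  by rewrite -mulmxA hUV eE !gh.
move=> c hx; apply/fsfunP => i; rewrite c0E hx sumE cV mxE.
by [].
Qed.

Section Denominators.
Variables (S B0 B1 : comPzRingType) (sg : {rmorphism S -> B0}).
Variables (io : {rmorphism B0 -> B1}) (good : S -> Prop).
Hypotheses (good1 : good 1) (goodM : forall s t, good s -> good t -> good (s * t)).
Hypothesis clear : forall x, exists s, good s /\ exists y, io y = io (sg s) * x.

(** Common denominators for the entries of a matrix. The set [good] of allowed
    denominators will be the complement of a maximal ideal, the nonzero
    polynomials, and the powers of a variable. *)
Lemma clear_mx m n (M : 'M[B1]_(m, n)) : exists s, good s /\
  exists M', map_mx io M' = io (sg s) *: M.
Proof.
have /choice[s hs] : forall ij : 'I_m * 'I_n, exists s, good s /\
    exists y, io y = io (sg s) * M ij.1 ij.2 by move=> ij; apply: clear.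
exists (\prod_ij s ij); split.
  by apply: big_ind => // ij _; case: (hs ij).
have /choice[g hg] : forall ij : 'I_m * 'I_n, exists y,
    io y = io (sg (\prod_ij s ij)) * M ij.1 ij.2.
  move=> ij; have [_ [y hy]] := hs ij; rewrite (bigD1 ij) //=.
  set t := \prod_(_ | _) _; exists (sg t * y).
  by rewrite !rmorphM hy mulrCA mulrA.
exists (\matrix_(a, b) g (a, b)); apply/matrixP => a b.
by have := hg (a, b); rewrite !mxE.
Qed.

End Denominators.

(** * Polynomial matrices *)

Section MonicCancel.
Variables (R : comNzRingType) (f : {poly R}).
Hypothesis fm : f \is monic.

Lemma monic_mulI : injective ( *%R f).
Proof. by apply/lreg_lead; rewrite (monicP fm); apply: lreg1. Qed.

Lemma monic_scaleI m n : injective ( *:%R f : 'M[{poly R}]_(m, n) -> _).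
Proof.
move=> A B /matrixP h; apply/matrixP => i j; apply: monic_mulI.
by have := h i j; rewrite !mxE.
Qed.

End MonicCancel.

Section DetMonic.
Variables (R : comNzRingType) (d : nat).

Lemma size_prod_monic (I : eqType) (s : seq I) (F : I -> {poly R}) :
  (forall i, F i \is monic) -> (forall i, size (F i) = d.+1) ->
  size (\prod_(i <- s) F i) = (size s * d).+1.
Proof.
move=> hm hs; elim: s => [|a s IH]; first by rewrite big_nil size_poly1.
rewrite big_cons size_monicM //; last by rewrite monic_neq0 // monic_prod.
by rewrite IH hs addSn addnS mulSn /=.
Qed.

(** In the expansion of the determinant, only the identity permutation reaches
    degree [r * d]. *)
Lemma det_monic r (A : 'M[{poly R}]_r) :
  (forall i, A i i \is monic) -> (forall i, size (A i i) = d.+1) ->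
  (forall i j, i != j -> (size (A i j) <= d)%N) -> \det A \is monic.
Proof.
move=> hm hs hd; rewrite /determinant (bigD1 (1%g : {perm 'I_r})) //=.
rewrite odd_perm1 expr0 mul1r (eq_bigr (fun i => A i i)); last first.
  by move=> i _; rewrite perm.perm1.
apply/monicP; rewrite lead_coefDl; first exact/monicP/monic_prod.
rewrite size_prod_monic // ltnS; apply: (leq_trans (size_sum _ _ _)).
apply/bigmax_leqP => s s1.
rewrite size_Msign.
have [k sk] : exists k, s k != k.
  apply/existsP; apply: contraR s1 => /existsPn h; apply/eqP/perm.permP => i.
  by rewrite perm.perm1; apply/eqP; have := h i; rewrite negbK.
apply: leq_trans (size_poly_prod_leq _ _) _.
rewrite leq_subLR (bigD1 k) //= -addSn.
have -> : size (index_enum 'I_r) = r by rewrite -[index_enum _]enumT size_enum_ord.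
rewrite card_ord.
have hk : (size (A k (s k)) < d.+1)%N by rewrite ltnS hd // eq_sym.
have : (\sum_(i < r | i != k) size (A i (s i)) <= \sum_(i < r | i != k) d.+1)%N.
  apply: leq_sum => i _; have [->|ne] := eqVneq (s i) i; first by rewrite hs.
  by rewrite ltnW // ltnS hd // eq_sym.
have -> : (\sum_(i < r | i != k) d.+1 = r.-1 * d.+1)%N.
  rewrite sum_nat_const; congr (_ * _)%N.
  by have := cardC1 k; rewrite card_ord.
have r0 : (0 < r)%N by apply: leq_trans (ltn_ord k).
move=> h; apply: leq_trans (leq_add hk h) _.
by case: r r0 {h A hm hs hd s s1 k sk hk} => //= r _; nia.
Qed.
End DetMonic.

(** * Horrocks' theorem over a local ring *)

Section Nakayama.
Variables (L : comNzRingType) (k : fieldType) (pi : {rmorphism L -> k}).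
Hypothesis pi_unit : forall x, pi x != 0 -> exists y, x * y = 1.

Local Notation bar := (map_mx (map_poly pi)).

Let pi_unit1 x : pi x = 1 -> exists y, x * y = 1.
Proof. by move=> h; apply: pi_unit; rewrite h oner_neq0. Qed.

Section Span.
Variables (n : nat) (N : 'cV[{poly L}]_n -> Prop).
Hypothesis ND : forall x y, N x -> N y -> N (x + y).
Hypothesis NZ : forall c x, N x -> N (c%:P *: x).

(** The determinant trick: [1 - mu] is invertible since its determinant maps to 1
    in the residue field. *)
Lemma nakayama_span (I : finType) (v : I -> 'cV[{poly L}]_n) (mu : I -> I -> L) :
  (forall i j, pi (mu i j) = 0) ->
  (forall i, N (v i - \sum_j (mu i j)%:P *: v j)) -> forall i, N (v i).
Proof.
move=> hmu hv i0; have N0 : N 0.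
  rewrite -(scale0r (v i0 - \sum_j (mu i0 j)%:P *: v j)) -[0](polyC0).
  exact: NZ.
have Nsum (J : finType) (F : J -> 'cV[{poly L}]_n) :
    (forall j, N (F j)) -> N (\sum_j F j).
  by move=> h; apply: big_ind.
pose A := \matrix_(i, j < #|I|) mu (enum_val i) (enum_val j).
have [|B [_ hB]] := @inv_of_map1 _ _ pi pi_unit1 _ (1%:M - A).
  rewrite map_mxB map_mx1 [X in _ - X](_ : _ = 0) ?subr0 //.
  by apply/matrixP => i j; rewrite !mxE; apply: hmu.
pose w (a : 'I_#|I|) := v (enum_val a) - \sum_j (mu (enum_val a) j)%:P *: v j.
have wE a : w a = \sum_b ((1%:M - A) a b)%:P *: v (enum_val b).
  rewrite /w (eq_bigl (mem I)) // big_enum_val.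
  under [RHS]eq_bigr do rewrite !mxE polyCB scalerBl.
  rewrite sumrB; congr (_ - _).
  rewrite (bigD1 a) //= eqxx mulr1n scale1r big1 ?addr0 //.
  by move=> b ba; rewrite eq_sym (negbTE ba) mulr0n polyC0 scale0r.
have -> : v i0 = \sum_a (B (enum_rank i0) a)%:P *: w a.
  under eq_bigr do rewrite wE scaler_sumr.
  rewrite exchange_big /=.
  under eq_bigr => b _.
    under eq_bigr do rewrite scalerA -polyCM.
    rewrite -scaler_suml -(raddf_sum (@polyC L)) /=.
    have := congr1 (fun M : 'M_#|I| => M (enum_rank i0) b) hB.
    rewrite !mxE => ->. over.
  rewrite /= (bigD1 (enum_rank i0)) //= eqxx mulr1n scale1r enum_rankK.
  rewrite big1 ?addr0 // => b ba.
  by rewrite eq_sym (negbTE ba) mulr0n polyC0 scale0r.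
by apply: Nsum => a; apply/NZ/hv.
Qed.

(** Reduce [z = d q + r]. If the reduction of [r] were not zero, it would be a
    nonzero multiple of that of the monic [q], against its degree. *)
Lemma map_poly_rem0 (q z : {poly L}) : q \is monic -> map_poly pi z = 0 ->
  map_poly pi (Pdiv.Ring.rmodp z q) = 0.
Proof.
move=> qm z0; have qm' : map_poly pi q \is monic by apply: monic_map.
have := congr1 (map_poly pi) (Pdiv.RingMonic.rdivp_eq qm z).
rewrite z0 rmorphD rmorphM /= => /esym/eqP; rewrite addr_eq0 => /eqP h.
have [d0|dn0] := eqVneq (map_poly pi (Pdiv.Ring.rdivp z q)) 0.
  by apply/eqP; rewrite -oppr_eq0 -h d0 mul0r.
have := congr1 (fun p : {poly k} => size p) h.
rewrite size_polyN size_Mmonic // => hs.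
have h1 : (size (map_poly pi (Pdiv.Ring.rmodp z q)) < size q)%N.
  apply: leq_ltn_trans (size_poly _ _) _.
  by rewrite Pdiv.Ring.ltn_rmodpN0 // monic_neq0.
have h2 : size (map_poly pi q) = size q.
  by rewrite size_map_poly_id0 // (monicP qm) rmorph1 oner_neq0.
move: h1 hs; rewrite h2; have : (0 < size (map_poly pi (Pdiv.Ring.rdivp z q)))%N.
  by rewrite size_poly_gt0.
move=> a b c; exfalso; move: b; rewrite ltnNge => /negP; apply.
rewrite -c; case: (size _) a => // a _.
by rewrite addSn /= leq_addl.
Qed.

Lemma col_expand D (y : 'cV[{poly L}]_n) : (forall i, (size (y i 0%R) <= D)%N) ->
  y = \sum_(j : 'I_n * 'I_D) ((y j.1 0)`_j.2)%:P *: ('X^(j.2) *: delta_mx j.1 0).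
Proof.
move=> hy; apply/matrixP => i o; rewrite (ord1 o) summxE.
rewrite -(pair_bigA _ (fun i1 (j : 'I_D) =>
  (((y i1 0)`_j)%:P *: ('X^j *: delta_mx i1 0)) i 0)) /=.
rewrite (bigD1 i) //= [X in _ + X]big1 ?addr0; last first.
  move=> i1 i1i; rewrite big1 // => j _.
  by rewrite !mxE eq_sym (negbTE i1i) !mulr0.
rewrite -[LHS](take_poly_id (hy i)) /take_poly poly_def.
apply: eq_bigr => j _.
by rewrite !mxE !eqxx mulr1 mul_polyC.
Qed.

(** The set [N] is only an [L]-submodule. Since it contains the multiples of the
    monic [q], the finitely many [v j] generate the ambient space modulo [N], and
    Nakayama's lemma over [L] applies. *)
Lemma nakayama_monic (q : {poly L}) : q \is monic ->
  (forall y : 'cV[{poly L}]_n, N (q *: y)) ->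
  (forall y : 'cV[{poly L}]_n, exists2 x, N x & bar (y - x) = 0) -> forall y, N y.
Proof.
move=> qm Nq Nbar y; pose D := (size q).-1.
pose v (j : 'I_n * 'I_D) : 'cV[{poly L}]_n := 'X^(j.2) *: delta_mx j.1 0.
have q0 : q != 0 by apply: monic_neq0.
have red (z : 'cV[{poly L}]_n) : exists x r : 'cV[{poly L}]_n,
    [/\ z = q *: x + r, bar z = 0 -> bar r = 0 &
       r = \sum_(j : 'I_n * 'I_D) ((r j.1 0)`_j.2)%:P *: v j].
  exists (\col_i Pdiv.Ring.rdivp (z i 0) q), (\col_i Pdiv.Ring.rmodp (z i 0) q).
  split.
  - apply/matrixP => i o; rewrite (ord1 o) !mxE mulrC.
    exact: Pdiv.RingMonic.rdivp_eq.
  - move=> z0; apply/matrixP => i o; rewrite !mxE; apply: map_poly_rem0 => //.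
    by have /matrixP/(_ i 0) := z0; rewrite !mxE.
  - apply: col_expand => i; rewrite mxE -ltnS prednK ?size_poly_gt0 //.
    by rewrite Pdiv.Ring.ltn_rmodpN0.
have vN : forall j, N (v j).
  have Nb j : exists mu : 'I_n * 'I_D -> L, (forall i, pi (mu i) = 0) /\
      N (v j - \sum_i (mu i)%:P *: v i).
    have [x Nx hx] := Nbar (v j).
    have [x' [r [zE /(_ hx) r0 rE]]] := red (v j - x).
    exists (fun i : 'I_n * 'I_D => (r i.1 0)`_i.2); split.
      move=> i; have /matrixP/(_ i.1 0) := r0; rewrite !mxE => /polyP/(_ i.2).
      by rewrite coef_map coef0.
    rewrite -rE -[v j](subrK x) zE addrAC addrK; exact: ND.
  have [mu hmu] := choice Nb.
  by apply: (nakayama_span (mu := mu)) => [i j|i]; case: (hmu i).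
have [x [r [-> _ ->]]] := red y.
have N0 : N 0 by rewrite -(scaler0 _ q).
by apply: ND => //; apply: big_ind => // j _; apply: NZ.
Qed.

End Span.
End Nakayama.

Section Hermite.
Variable k : fieldType.

(** A combination of the entries with least degree divides all the entries. *)
Lemma row_gcd N (w : 'rV[{poly k}]_N) : exists (d : {poly k}) x y,
  [/\ w *m x = d%:M, d *: y = w & d = 0 \/ d \is monic].
Proof.
have [->|w0] := eqVneq w 0.
  by exists 0, 0, 0; rewrite mul0mx raddf0 scaler0; split=> //; left.
pose P n := `[< exists x : 'cV_N, (w *m x) 0 0 != 0 /\ size ((w *m x) 0 0) = n >].
have exP : exists n, P n.
  have /rV0Pn[j wj] := w0; exists (size (w 0 j)); apply/asboolP.
  by exists (delta_mx j 0); rewrite -colE mxE.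
case: (ex_minnP exP) => n /asboolP[x [d0 dn]] nmin.
pose d : {poly k} := (w *m x) 0 0.
have dvd j : exists q : {poly k}, w 0 j = d * q.
  exists (w 0 j %/ d); apply/eqP; rewrite -subr_eq0.
  have e : w 0 j - d * (w 0 j %/ d) = w 0 j %% d.
    by rewrite {1}(divp_eq (w 0 j) d) [d * _]mulrC addrC addKr.
  rewrite e; apply: contraT => r0.
  have := nmin (size (w 0 j %% d)); rewrite leqNgt -dn ltn_modp d0 => h.
  apply: contraTT (h _) => //; apply/asboolP.
  exists (delta_mx j 0 - (w 0 j %/ d) *: x).
  suff -> : (w *m (delta_mx j 0 - (w 0 j %/ d) *: x)) 0 0 = w 0 j %% d by [].
  rewrite mulmxBr -colE -scalemxAr -e [d * _]mulrC.
  by rewrite mxE [X in X + _]mxE [X in _ + X]mxE [X in _ - X]mxE.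
have [q hq] := choice dvd.
have lc : lead_coef d != 0 by rewrite lead_coef_eq0.
exists ((lead_coef d)^-1 *: d), ((lead_coef d)^-1%:P *: x).
exists ((lead_coef d)%:P *: \row_j q j); split.
- by rewrite -scalemxAr [w *m x]mx11_scalar scale_scalar_mx mul_polyC.
- apply/rowP => j; rewrite !mxE hq -!mul_polyC mulrACA -polyCM mulVf //.
  by rewrite mul1r.
- by right; rewrite monicE lead_coefZ mulVf.
Qed.

(** Column reduction to a triangular matrix, one row at a time: if [x] combines
    the first row to its gcd, then right multiplication by [1 - x y] clears this
    row. *)
Lemma hermite r N (W : 'M[{poly k}]_(r, N)) : exists (T : 'M_r) X Y,
  [/\ W *m X = T, T *m Y = W, is_trig_mx T &
      forall i, T i i = 0 \/ T i i \is monic].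
Proof.
elim: r W => [|r IH]; last rewrite -[r.+1]/(1 + r)%N; move=> W.
  exists 0, 0, 0; split; try by apply/matrixP; case.
    by apply/is_trig_mxP; case.
  by case.
rewrite -[W]vsubmxK.
move: (usubmx W) (dsubmx W) => w W'.
have [d [x [y [wx dy dm]]]] := row_gcd w.
have [T [X [Y [h1 h2 h3 h4]]]] := IH (W' *m (1%:M - x *m y)).
exists (block_mx d%:M 0 (W' *m x) T), (row_mx x ((1%:M - x *m y) *m X)).
exists (col_mx y Y).
have w0 : w *m (1%:M - x *m y) = 0.
  by rewrite mulmxBr mulmx1 mulmxA wx mul_scalar_mx dy subrr.
split.
- by rewrite mul_col_row wx !mulmxA w0 h1 mul0mx.
- rewrite mul_block_col mul0mx addr0 h2 mul_scalar_mx dy mulmxBr mulmx1 mulmxA.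
  by rewrite addrC subrK.
- by rewrite is_trig_block_mx // eqxx h3 scalar_mx_is_trig.
- move=> i; case: (split_ordP i) => j ->; rewrite ?block_mxEul ?block_mxEdr //.
  by rewrite (ord1 j) mxE.
Qed.

End Hermite.

Section HorrocksLocal.
Variables (L : comNzRingType) (k : fieldType) (pi : {rmorphism L -> k}).
Hypothesis pi_surj : forall y, exists x, pi x = y.
Hypothesis pi_unit : forall x, pi x != 0 -> exists y, x * y = 1.

Local Notation bar := (map_mx (map_poly pi)).

Lemma map_poly_surj (q : {poly k}) : exists p, map_poly pi p = q.
Proof.
have [g hg] := choice pi_surj; exists (\poly_(i < size q) g q`_i).
apply/polyP => i; rewrite coef_map coef_poly; case: ltnP => h //=.
by rewrite raddf0 nth_default.
Qed.

Lemma monic_lift (q : {poly k}) : q \is monic ->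
  exists2 p, p \is monic & map_poly pi p = q.
Proof.
move=> qm; pose n := (size q).-1.
have [p0 hp0] := map_poly_surj q.
exists ('X^n + \poly_(i < n) p0`_i).
  by apply/monicP; rewrite lead_coefDl ?lead_coefXn // size_polyXn ltnS size_poly.
apply/polyP => i; rewrite rmorphD /= map_polyXn coefD coefXn coef_map coef_poly.
have sq : size q = n.+1 by rewrite prednK // size_poly_gt0 monic_neq0.
have [->|ne] := eqVneq i n.
  by rewrite ltnn /= raddf0 addr0 -(monicP qm) lead_coefE.
rewrite add0r; case: ltnP => [_|ni]; first by rewrite -hp0 coef_map.
by rewrite raddf0 nth_default // sq ltn_neqAle eq_sym ne.
Qed.

Lemma cols_eq (A : comNzRingType) m n (M M' : 'M[A]_(m, n)) :
  (forall j, col j M = col j M') -> M = M'.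
Proof. by move=> h; apply/trmx_inj/row_matrixP => i; rewrite -!tr_col h. Qed.

Lemma choice_col (A : comNzRingType) m n p
    (P : 'I_n -> 'cV[A]_m -> 'cV[A]_p -> Prop) :
  (forall j, exists x y, P j x y) ->
  exists (X : 'M_(m, n)) (Y : 'M_(p, n)), forall j, P j (col j X) (col j Y).
Proof.
move=> h; have /choice[f hf] : forall j, exists f : 'cV[A]_m * 'cV[A]_p,
    P j f.1 f.2.
  by move=> j; have [x [y hxy]] := h j; exists (x, y).
exists (\matrix_(i, j) (f j).1 i 0), (\matrix_(i, j) (f j).2 i 0) => j.
have -> : col j (\matrix_(i, j) (f j).1 i 0) = (f j).1.
  by apply/colP => i; rewrite !mxE.
have -> : col j (\matrix_(i, j) (f j).2 i 0) = (f j).2; last exact: hf.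
by apply/colP => i; rewrite !mxE.
Qed.

(** Over the residue field, the Hermite form of the coordinates [V] provides a
    basis [b] of the image of [e] for which [V b] is triangular with a monic
    diagonal. This shape matters: such a matrix lifts to one with monic
    determinant. *)
Lemma residual_basis N r (e : 'M[{poly k}]_N) (U : 'M_(N, r)) (V : 'M_(r, N)) f :
  e *m e = e -> V *m e = V -> V *m U = f%:M -> U *m V = f *: e ->
  f \is monic ->
  exists b c, [/\ e *m b = b, b *m c = e, is_trig_mx (V *m b) &
     forall i, (V *m b) i i \is monic].
Proof.
move=> he Ve VU UV fm.
have [T [X [Y [h1 h2 h3 h4]]]] := hermite V.
have dT : \det T != 0.
  apply: contraTneq fm => d0.
  have : \det (T *m (Y *m U)) = 0 by rewrite det_mulmx d0 mul0r.
  rewrite mulmxA h2 VU det_scalar => /eqP; rewrite expf_eq0 => /andP[_ /eqP ->].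
  by rewrite monicE lead_coef0 eq_sym oner_eq0.
exists (e *m X), (Y *m e); split; first by rewrite mulmxA he.
- apply: (monic_scaleI fm); rewrite !scalemxAl -UV -!mulmxA (mulmxA V) h1.
  by rewrite (mulmxA T) h2 Ve.
- by rewrite mulmxA Ve h1.
- move=> i; rewrite mulmxA Ve h1; case: (h4 i) => // Ti0.
  by move: dT; rewrite (det_trig h3) (bigD1 i) //= Ti0 mul0r eqxx.
Qed.

(** After inverting [f], the columns of [U] are a basis of the image [P] of [e].
    Let [T] be a triangular lift of the matrix of [residual_basis] and let [g] be
    its determinant. The basis [U T / f], with coordinates [W / g], reduces to
    the basis [b] of the special fibre: the bundle on the projective line that
    it defines has a trivial special fibre.
    Nakayama's lemma gives [cover], and with it a lift [Z1] of [b] such that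
    [W Z1 - g] has degree less than [deg g]. The determinant of [W Z1] is then
    monic and kills the cokernel of [Z1] in [P]. So this cokernel is finite over
    [L]; it vanishes on the special fibre, hence it is zero. *)
Theorem horrocks_local N r (e : 'M[{poly L}]_N) (U : 'M_(N, r)) (V : 'M_(r, N)) f :
  e *m e = e -> e *m U = U -> V *m e = V -> V *m U = f%:M -> U *m V = f *: e ->
  f \is monic -> mvn e (1%:M : 'M_r).
Proof.
move=> he eU Ve VU UV fm.
have [b [c [eb bc trg dm]]] : exists b c, [/\ bar e *m b = b, b *m c = bar e,
    is_trig_mx (bar V *m b) & forall i, (bar V *m b) i i \is monic].
  apply: (residual_basis (U := bar U) (f := map_poly pi f)).
  - by rewrite -map_mxM he.
  - by rewrite -map_mxM Ve.
  - by rewrite -map_mxM VU map_scalar_mx.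
  - by rewrite -map_mxM UV map_mxZ.
  - exact: monic_map.
have [T [Tt Td Tb]] : exists T : 'M[{poly L}]_r,
    [/\ is_trig_mx T, forall i, T i i \is monic & bar T = bar V *m b].
  have /choice[F hF] : forall ij : 'I_r * 'I_r, exists F : {poly L},
      [/\ (ij.1 < ij.2)%N -> F = 0, ij.1 = ij.2 -> F \is monic &
          map_poly pi F = (bar V *m b) ij.1 ij.2].
    move=> [i j] /=; have [<-|ij] := eqVneq i j.
      have [p pm hp] := monic_lift (dm i); exists p; split=> //.
      by rewrite ltnn.
    have [lt|ge] := ltnP i j.
      exists 0; split=> //; first by move=> eij; rewrite eij eqxx in ij.
      by rewrite raddf0; have /is_trig_mxP -> := trg.
    have [p hp] := map_poly_surj ((bar V *m b) i j); exists p; split=> //.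
    by move=> eij; rewrite eij eqxx in ij.
  exists (\matrix_(i, j) F (i, j)); split.
  - apply/is_trig_mxP => i j lt; rewrite mxE.
    by case: (hF (i, j)) => h _ _; apply: h.
  - by move=> i; rewrite mxE; case: (hF (i, i)) => _ h _; apply: h.
  - by apply/matrixP => i j; rewrite 2!mxE; case: (hF (i, j)).
pose g := \det T.
have gm : g \is monic by rewrite /g (det_trig Tt) monic_prod.
have g0 : (0 < size g)%N by rewrite size_poly_gt0 monic_neq0.
pose W := \adj T *m V.
have WUT : W *m (U *m T) = (f * g)%:M.
  rewrite /W -mulmxA (mulmxA V) VU mul_scalar_mx -scalemxAr mul_adj_mx.
  by rewrite scale_scalar_mx.
have UTW : (U *m T) *m W = (f * g) *: e.
  rewrite /W -mulmxA (mulmxA T) mul_mx_adj mul_scalar_mx -scalemxAr UV scalerA.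
  by rewrite mulrC.
have We : W *m e = W by rewrite /W -mulmxA Ve.
have Wb : bar W *m b = (map_poly pi g)%:M.
  by rewrite /W map_mxM map_mx_adj -mulmxA -Tb mul_adj_mx det_map_mx.
have qm : f * g \is monic by rewrite monicMl.
clearbody W; clearbody g.
have [b' hb'] := surj_mx map_poly_surj b.
pose Z0 := e *m b'.
have bZ0 : bar Z0 = b by rewrite /Z0 map_mxM hb' eb.
have eZ0 : e *m Z0 = Z0 by rewrite /Z0 mulmxA he.
clearbody Z0.
(* The remainders [rho / g] are the sections at infinity of the bundle twisted
   by -1; the statement is the vanishing of its H^1, which is clear on the
   special fibre because [bar W *m b] is the scalar [g]. *)
have cover (y : 'cV[{poly L}]_r) : exists z rho, y = W *m z + rho /\
    forall i, (size (rho i 0%R) < size g)%N.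
  move: y; apply: (nakayama_monic (pi := pi) pi_unit _ _ qm).
  - move=> _ _ [z1 [r1 [-> h1]]] [z2 [r2 [-> h2]]]; exists (z1 + z2), (r1 + r2).
    split; first by rewrite mulmxDr addrACA.
    move=> i; rewrite mxE; apply: leq_ltn_trans (size_polyD _ _) _.
    by rewrite gtn_max h1 h2.
  - move=> a _ [z1 [r1 [-> h1]]]; exists (a%:P *: z1), (a%:P *: r1).
    split; first by rewrite -scalemxAr scalerDr.
    move=> i; rewrite mxE mul_polyC; apply: leq_ltn_trans (h1 i).
    exact: size_scale_leq.
  - move=> y; exists ((U *m T) *m y), 0; split.
      by rewrite addr0 mulmxA WUT mul_scalar_mx.
    by move=> i; rewrite mxE size_poly0.
  - move=> y; pose qu := \col_i Pdiv.Ring.rdivp (y i 0) g.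
    pose re := \col_i Pdiv.Ring.rmodp (y i 0) g.
    have yE : y = g *: qu + re.
      apply/colP => i; rewrite !mxE mulrC; exact: Pdiv.RingMonic.rdivp_eq.
    exists (W *m (Z0 *m qu) + re).
      exists (Z0 *m qu), re; split=> // i; rewrite mxE.
      by rewrite Pdiv.Ring.ltn_rmodpN0 // monic_neq0.
    rewrite {1}yE [X in map_mx _ X](_ : _ = g *: qu - W *m (Z0 *m qu)); last first.
      by rewrite opprD addrACA subrr addr0.
    rewrite map_mxB map_mxZ !map_mxM bZ0 mulmxA Wb.
    by rewrite mul_scalar_mx subrr.
have cover0 (y : 'cV[{poly L}]_r) : bar y = 0 -> exists z rho,
    [/\ y = W *m z + rho, bar z = 0 & forall i, (size (rho i 0%R) < size g)%N].
  move=> y0; pose D := (\max_i size (y i 0%R))%N.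
  rewrite (@col_expand _ _ D y) => [|i]; last exact: leq_bigmax.
  have : forall j : 'I_r * 'I_D, pi ((y j.1 0)`_j.2) = 0.
    move=> j; have /matrixP/(_ j.1 0) := y0; rewrite !mxE => /polyP/(_ j.2).
    by rewrite coef_map coef0.
  move=> hF.
  apply: (big_ind (fun y => exists z rho, [/\ y = W *m z + rho, bar z = 0 &
    forall i, (size (rho i 0%R) < size g)%N])).
  - exists 0, 0; split; rewrite ?mulmx0 ?addr0 ?map_mx0 //.
    by move=> i; rewrite mxE size_poly0.
  - move=> _ _ [z1 [r1 [-> b1 h1]]] [z2 [r2 [-> b2 h2]]].
    exists (z1 + z2), (r1 + r2).
    split; first by rewrite mulmxDr addrACA.
      by rewrite map_mxD b1 b2 addr0.
    move=> i; rewrite mxE; apply: leq_ltn_trans (size_polyD _ _) _.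
    by rewrite gtn_max h1 h2.
  - move=> j _; have [z [rho [-> h]]] := cover ('X^(j.2) *: delta_mx j.1 0).
    exists (((y j.1 0)`_j.2)%:P *: z), (((y j.1 0)`_j.2)%:P *: rho); split.
    + by rewrite -scalemxAr scalerDr.
    + by rewrite map_mxZ /= map_polyC /= hF polyC0 scale0r.
    + move=> i; rewrite mxE mul_polyC; apply: leq_ltn_trans (h i).
      exact: size_scale_leq.
(* Correct [Z0] by an element of the maximal ideal, so as to remove from
   [W Z0 - g] all the terms of degree at least [deg g]. *)
have [Zc [R hZR]] : exists (Z : 'M[{poly L}]_(N, r)) (R : 'M[{poly L}]_(r, r)),
   forall j, [/\ col j (g%:M - W *m Z0) = W *m col j Z + col j R, bar (col j Z) = 0 &
      forall i, (size ((col j R) i 0%R) < size g)%N].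
  apply: (choice_col (P := fun j z rho =>
    [/\ col j (g%:M - W *m Z0) = W *m z + rho, bar z = 0 &
        forall i, (size (rho i 0%R) < size g)%N])) => j.
  apply: cover0; rewrite map_col map_mxB map_mxM bZ0 Wb map_scalar_mx subrr.
  by apply/colP => i; rewrite !mxE.
pose Z1 := Z0 + e *m Zc.
have bZc : bar Zc = 0.
  apply/matrixP => i j; have [_ /matrixP/(_ i 0) + _] := hZR j; by rewrite !mxE.
have bZ1 : bar Z1 = b by rewrite map_mxD map_mxM bZc mulmx0 addr0 bZ0.
have eZ1 : e *m Z1 = Z1 by rewrite mulmxDr eZ0 mulmxA he.
pose Th := g%:M - R.
have WZ1 : W *m Z1 = Th.
  rewrite mulmxDr mulmxA We; suff -> : W *m Zc = g%:M - W *m Z0 - R.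
    by rewrite addrA [W *m Z0 + _]addrC subrK.
  apply: cols_eq => j; have [h _ _] := hZR j.
  rewrite [RHS]colE mulmxBl -!colE h addrK !colE mulmxA //.
have thm : \det Th \is monic.
  have Rs i j : (size (R i j) < size g)%N.
    by have [_ _ /(_ i)] := hZR j; rewrite mxE.
  apply: (det_monic (d := (size g).-1)) => [i|i|i j ij].
  - rewrite !mxE eqxx mulr1n monicE lead_coefDl ?size_polyN //.
  - by rewrite !mxE eqxx mulr1n size_polyDl ?size_polyN // prednK.
  - by rewrite !mxE (negbTE ij) mulr0n add0r size_polyN -ltnS prednK.
have ThW : Z1 *m (\adj Th *m W) = \det Th *: e.
  apply: (monic_scaleI qm); rewrite scalemxAl -{1}eZ1 scalemxAl -UTW.
  rewrite -!mulmxA (mulmxA W Z1) WZ1 (mulmxA Th) mul_mx_adj mul_scalar_mx.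
  by rewrite -!scalemxAr mulmxA UTW !scalerA mulrC.
have [c' hc'] := surj_mx map_poly_surj c.
(* The cokernel of [Z1] is zero, by Nakayama again. *)
have span (x : 'cV[{poly L}]_N) : exists y z, x = Z1 *m y + (1%:M - e) *m z.
  move: x; apply: (nakayama_monic (pi := pi) pi_unit _ _ thm).
  - move=> _ _ [y1 [z1 ->]] [y2 [z2 ->]]; exists (y1 + y2), (z1 + z2).
    by rewrite !mulmxDr addrACA.
  - move=> a _ [y1 [z1 ->]]; exists (a%:P *: y1), (a%:P *: z1).
    by rewrite -!scalemxAr scalerDr.
  - move=> x; exists ((\adj Th *m W) *m x), (\det Th *: x).
    rewrite mulmxA ThW -scalemxAl -scalemxAr mulmxBl mul1mx scalerBr addrC.
    by rewrite subrK.
  - move=> x; exists (Z1 *m (c' *m x) + (1%:M - e) *m x).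
      by exists (c' *m x), x.
    rewrite map_mxB map_mxD !map_mxM map_mxB map_mx1 bZ1 hc' mulmxA bc.
    by rewrite mulmxBl mul1mx addrC [_ + (_ - _)]addrC subrK addNr.
have [Y [Z hYZ]] := choice_col
  (P := fun j y z => col j 1%:M = Z1 *m y + (1%:M - e) *m z)
  (fun j => span (col j 1%:M)).
have YZ : 1%:M = Z1 *m Y + (1%:M - e) *m Z.
  by apply: cols_eq => j; rewrite hYZ !colE [RHS]mulmxDl !mulmxA.
have ZY : Z1 *m Y = e.
  have := congr1 (mulmx e) YZ; rewrite mulmx1 mulmxDr !mulmxA eZ1.
  by rewrite mulmxBr mulmx1 he subrr mul0mx addr0 => ->.
exists Z1, Y; split=> //; apply: (monic_scaleI thm).
rewrite -!mul_scalar_mx mulmx1 -mul_adj_mx -mulmxA; congr (_ *m _).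
by rewrite -{1}WZ1 -mulmxA (mulmxA Z1) ZY eZ1.
Qed.
End HorrocksLocal.

(** * Residue fields and localization at a maximal ideal *)

Lemma field_of_inverses (R : comNzRingType) :
  (forall x : R, x != 0 -> exists y, x * y = 1) ->
  exists (k : fieldType) (f : {rmorphism R -> k}),
    (forall y, exists x, f x = y) /\ forall x, f x = 0 -> x = 0.
Proof.
move=> h; have /choice[g hg] : forall x : R, exists y,
    (x != 0 -> x * y = 1) /\ (x = 0 -> y = 0).
  move=> x; have [->|x0] := eqVneq x 0; first by exists 0.
  by have [y hy] := h x x0; exists y; split=> // e; rewrite e eqxx in x0.
have gV x : x != 0 -> g x * x = 1 by rewrite mulrC; case: (hg x).
have g0 : g 0 = 0 by case: (hg 0) => _; apply.
pose kT := GRing.ComNzRing_isField.Build R gV g0.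
pose k : fieldType := HB.pack (GRing.ComNzRing.sort R) kT.
pose f : R -> k := fun x => x.
have fz : zmod_morphism f by [].
have fm : GRing.monoid_morphism f by [].
pose fR : {rmorphism R -> k} :=
  HB.pack f (GRing.isZmodMorphism.Build _ _ f fz)
    (GRing.isMonoidMorphism.Build _ _ f fm).
by exists k, fR; split=> // y; exists y.
Qed.

Section MaximalIdeal.
Variables (A : comNzRingType) (m : A -> Prop).
Hypotheses (m0 : m 0) (mD : forall x y, m x -> m y -> m (x + y)).
Hypotheses (mM : forall a x, m x -> m (a * x)) (m1 : ~ m 1).
Hypothesis mmax : forall x, ~ m x -> exists a, m (1 - x * a).

Definition max_ideal : {pred A} := fun x => `[< m x >].

Fact max_ideal_closed : idealr_closed max_ideal.
Proof.
split; [exact/asboolP| exact/asboolPn|].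
by move=> a x y /asboolP hx /asboolP hy; apply/asboolP/mD => //; apply: mM.
Qed.
HB.instance Definition _ := isIdealr.Build A max_ideal max_ideal_closed.

Lemma residue_field_of_max : exists (k : fieldType) (f : {rmorphism A -> k}),
  (forall y, exists x, f x = y) /\ forall x, m x -> f x = 0.
Proof.
pose Q := {ideal_quot max_ideal}.
have pi0 x : m x -> \pi_Q%qT x = 0 :> Q.
  move=> mx; rewrite -[0](pi_zeror); apply/eqP.
  by rewrite -Quotient.idealrBE subr0; apply/asboolP.
have [x0|k [f [fs fi]]] := @field_of_inverses Q.
  move: x0; elim/quotW => x x0; have [a ha] : exists a, m (1 - x * a).
    by apply: mmax => mx; move: x0; rewrite pi0 ?eqxx.
  exists (\pi_Q%qT a); rewrite -rmorphM.
  by apply/eqP; rewrite eq_sym -subr_eq0 -(rmorph1 \pi_Q%qT) -rmorphB /= pi0.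
exists k, (f \o \pi_Q%qT : {rmorphism A -> k}); split=> [y|x /pi0 h] /=.
  by have [x <-] := fs y; exists (repr x); rewrite /= reprK.
by rewrite h rmorph0.
Qed.
End MaximalIdeal.

Lemma residue_field (A : comNzRingType) (I : A -> Prop) :
  I 0 -> (forall x y, I x -> I y -> I (x + y)) ->
  (forall a x, I x -> I (a * x)) -> ~ I 1 ->
  exists (k : fieldType) (f : {rmorphism A -> k}),
    (forall y, exists x, f x = y) /\ forall x, I x -> f x = 0.
Proof.
move=> I0 ID IM I1; pose ideal (m : set A) := [/\ forall x, I x -> m x,
  forall x y, m x -> m y -> m (x + y), forall a x, m x -> m (a * x) & ~ m 1].
have Iid : ideal I by split.
(* The empty set is admitted as the union of the empty chain. *)
have [F Fi tot|m [mi mmax]] := @Zorn_bigcup A (fun m => m = set0 \/ ideal m).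
  have [[X FX [x Xx]]|no] := pselect (exists2 X, F X & X !=set0)%classic; last first.
    left; apply/seteqP; split=> // x [X FX Xx].
    by apply: no; exists X => //; exists x.
  have Fid Y y : F Y -> Y y -> ideal Y.
    by move=> FY Yy; case: (Fi Y FY) => // Y0; rewrite Y0 in Yy.
  right; split.
  - move=> y Iy; exists X => //; have [h _ _ _] := Fid X x FX Xx; exact: h.
  - move=> y z [Y FY Yy] [Z FZ Zz]; have [YZ|ZY] := tot _ _ FY FZ.
      by exists Z => //; have [_ h _ _] := Fid Z z FZ Zz; apply: h => //; apply: YZ.
    by exists Y => //; have [_ h _ _] := Fid Y y FY Yy; apply: h => //; apply: ZY.
  - move=> a y [Y FY Yy]; exists Y => //; have [_ _ h _] := Fid Y y FY Yy; exact: h.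
  - by move=> [Y FY Y1]; have [_ _ _ h] := Fid Y 1 FY Y1.
have {mi}[mI mD mM m1] : ideal m.
  case: mi => // me; exfalso; apply: (mmax I); last by right.
  by rewrite me; split=> // /(_ 0 I0).
have [|||||k [f [fs fm]]] := @residue_field_of_max A m; rewrite //.
- exact: mI.
- move=> x nx; pose m' := [set y | exists a b, m b /\ y = b + x * a]%classic.
  apply: contrapT => na; apply: (mmax m').
    split=> [y my|]; first by exists 0, y; rewrite mulr0 addr0.
    move=> h; apply: nx; apply: h.
    by exists 1, 0; split; [exact: mI|rewrite add0r mulr1].
  right; split.
  - by move=> y Iy; exists 0, y; rewrite mulr0 addr0; split=> //; apply: mI.
  - move=> _ _ [a [b [mb ->]]] [c [d [md ->]]]; exists (a + c), (b + d).
    by rewrite mulrDr addrACA; split=> //; apply: mD.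
  - move=> c _ [a [b [mb ->]]]; exists (c * a), (c * b).
    by rewrite mulrDr mulrCA; split=> //; apply: mM.
  - move=> [a [b [mb e]]]; apply: na; exists a.
    by rewrite e addrK.
by exists k, f; split=> // x /mI /fm.
Qed.

(** The localization of [A] at the kernel of [f] is taken inside a field [Om] that
    contains [A]. *)
Section Localization.
Variables (A : comNzRingType) (Om : fieldType) (io : {rmorphism A -> Om}).
Variables (k : fieldType) (f : {rmorphism A -> k}).
Hypothesis io_inj : injective io.

Definition frac_at (z : Om) (x : A * A) : Prop :=
  f x.2 != 0 /\ z * io x.2 = io x.1.

Definition local_pred : {pred Om} := fun z => `[< exists x, frac_at z x >].

Lemma f_neq0 s : f s != 0 -> io s != 0.
Proof.
apply: contra => /eqP s0; have : io s = io 0 by rewrite s0 rmorph0.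
by move/io_inj ->; rewrite rmorph0.
Qed.

Lemma frac_atB z z' x x' : frac_at z x -> frac_at z' x' ->
  frac_at (z - z') (x.1 * x'.2 - x'.1 * x.2, x.2 * x'.2).
Proof.
move=> [h1 h2] [h3 h4]; split; first by rewrite rmorphM mulf_neq0.
rewrite /= !(rmorphB, rmorphM) /= -h2 -h4.
by rewrite mulrBl mulrA; congr (_ - _); rewrite mulrCA mulrC.
Qed.

Lemma frac_atM z z' x x' : frac_at z x -> frac_at z' x' ->
  frac_at (z * z') (x.1 * x'.1, x.2 * x'.2).
Proof.
move=> [h1 h2] [h3 h4]; split; first by rewrite rmorphM mulf_neq0.
by rewrite /= !rmorphM /= -h2 -h4 mulrACA.
Qed.

Lemma frac_at_io a : frac_at (io a) (a, 1).
Proof. by split; rewrite /= ?rmorph1 ?oner_neq0 ?mulr1. Qed.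

Fact local_subring : subring_closed local_pred.
Proof.
split.
- by apply/asboolP; exists (1, 1); rewrite -(rmorph1 io); apply: frac_at_io.
- move=> z z' /asboolP[x h] /asboolP[x' h']; apply/asboolP.
  by eexists; apply: frac_atB h h'.
- move=> z z' /asboolP[x h] /asboolP[x' h']; apply/asboolP.
  by eexists; apply: frac_atM h h'.
Qed.

HB.instance Definition _ := GRing.isSubringClosed.Build Om local_pred local_subring.

Record local_ring := LocalRing { lr_val : Om; lr_valP : lr_val \in local_pred }.

HB.instance Definition _ := [isSub for lr_val].
HB.instance Definition _ := [Choice of local_ring by <:].
HB.instance Definition _ := [SubChoice_isSubComNzRing of local_ring by <:].

Lemma localization : exists (L : comNzRingType) (f' : {rmorphism L -> k})
    (i : {rmorphism A -> L}),
  [/\ injective i, forall a, f' (i a) = f a,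
      forall x, f' x != 0 -> exists y, x * y = 1 &
      forall x, exists a s, f s != 0 /\ x * i s = i a].
Proof.
have lP (x : local_ring) : exists y, frac_at (val x) y.
  by apply/asboolP; apply: (valP x).
have /choice[g hg] := lP.
pose f' (x : local_ring) := f (g x).1 / f (g x).2.
have f'E (x : local_ring) y : frac_at (val x) y -> f' x = f y.1 / f y.2.
  move=> [h1 h2]; have [h3 h4] := hg x.
  have e : (g x).1 * y.2 = y.1 * (g x).2.
    by apply: io_inj; rewrite !rmorphM -h4 -h2 /= mulrAC.
  apply/eqP; rewrite /f' eqr_div // -!rmorphM e mulrC //.
have fz : zmod_morphism f'.
  move=> x y; have [h1 h2] := (hg x, hg y).
  rewrite (f'E (x - y) _ (frac_atB h1 h2)) /= /f'.
  case: h1 h2 => [s1 _] [s2 _]; rewrite rmorphB !rmorphM /=.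
  by rewrite -[X in _ = _ + X]mulNr addf_div // mulNr.
have fm : GRing.monoid_morphism f'.
  split.
    rewrite (f'E 1 (1, 1)) /= ?rmorph1 ?divr1 // -(rmorph1 io).
    exact: frac_at_io.
  move=> x y; have [h1 h2] := (hg x, hg y).
  rewrite (f'E (x * y) _ (frac_atM h1 h2)) /= /f' !rmorphM /=.
  by rewrite invfM mulrACA.
pose fR : {rmorphism local_ring -> k} :=
  HB.pack f' (GRing.isZmodMorphism.Build _ _ f' fz)
    (GRing.isMonoidMorphism.Build _ _ f' fm).
have ioP a : io a \in local_pred by apply/asboolP; eexists; apply: frac_at_io.
pose i a := LocalRing (ioP a).
have iz : zmod_morphism i by move=> x y; apply: val_inj; rewrite /= rmorphB.
have im : GRing.monoid_morphism i.
  by split=> [|x y]; apply: val_inj; rewrite /= ?rmorph1 ?rmorphM.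
pose iR : {rmorphism A -> local_ring} :=
  HB.pack i (GRing.isZmodMorphism.Build _ _ i iz)
    (GRing.isMonoidMorphism.Build _ _ i im).
exists local_ring, fR, iR; split.
- by move=> a b /(congr1 val)/io_inj.
- by move=> a; rewrite /= (f'E (i a) _ (frac_at_io a)) rmorph1 divr1.
- move=> x fx0; have [[a s] [/= s0 h]] := lP x.
  have a0 : f a != 0.
    apply: contra fx0 => /eqP a0.
    by rewrite /= (f'E x (a, s)) //= a0 mul0r.
  have yP : (io s / io a) \in local_pred.
    by apply/asboolP; exists (s, a); split=> //=; rewrite divfK // f_neq0.
  exists (LocalRing yP); apply: val_inj => /=.
  by rewrite mulrA h mulfV // f_neq0.
- move=> x; have [[a s] [/= s0 h]] := lP x; exists a, s; split=> //.
  exact: val_inj.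
Qed.
End Localization.

(** * Extending projective modules from the coefficients *)

Section Substitution.
Variables (A D : comNzRingType) (h : {rmorphism A -> D}).

Definition subst (x : D) : {poly A} -> D := horner_eval x \o map_poly h.
HB.instance Definition _ x := GRing.RMorphism.on (subst x).

Lemma substE x p : subst x p = (map_poly h p).[x]. Proof. by []. Qed.

Lemma substC x a : subst x a%:P = h a.
Proof. by rewrite substE map_polyC hornerC. Qed.

Lemma substX x : subst x 'X = x.
Proof. by rewrite substE map_polyX hornerX. Qed.

Lemma horner_shift (q : {poly D}) a b : exists w, q.[a + b] = q.[a] + b * w.
Proof.
elim/poly_ind: q => [|q c [w hw]]; first by exists 0; rewrite !horner0 mulr0 addr0.
exists (q.[a] + w * (a + b)); rewrite !hornerMXaddC hw.
by rewrite mulrDl !mulrDr !mulrA; ring.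
Qed.

Lemma subst_shift m n (M : 'M[{poly A}]_(m, n)) x c y : exists W,
  map_mx (subst (x + c * y)) M = map_mx (subst x) M + c *: W.
Proof.
have /choice[w hw] : forall ij : 'I_m * 'I_n, exists w,
    subst (x + c * y) (M ij.1 ij.2) = subst x (M ij.1 ij.2) + c * w.
  move=> ij; rewrite !substE.
  have [w ->] := horner_shift (map_poly h (M ij.1 ij.2)) x (c * y).
  by exists (y * w); rewrite mulrA.
exists (\matrix_(i, j) w (i, j)); apply/matrixP => i j.
by have := hw (i, j); rewrite !mxE.
Qed.

End Substitution.

Lemma subst_comp (A D D' : comNzRingType) (h : {rmorphism A -> D})
    (h' : {rmorphism A -> D'}) (g : {rmorphism D -> D'}) x p :
  (forall a, g (h a) = h' a) -> g (subst h x p) = subst h' (g x) p.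
Proof.
move=> e; rewrite !substE -horner_map -map_poly_comp.
by congr (_.[_]); apply: eq_map_poly => a; rewrite /= e.
Qed.

Section PolyDenominators.
Variables (A L : comNzRingType) (k : fieldType) (i : {rmorphism A -> L}).
Variable f : {rmorphism A -> k}.
Hypothesis iP : forall x, exists a s, f s != 0 /\ x * i s = i a.

Lemma clear_poly (p : {poly L}) : exists s, f s != 0 /\
  exists p', map_poly i p' = map_poly i s%:P * p.
Proof.
elim/poly_ind: p => [|p c [s [s0 [p' hp']]]].
  by exists 1; rewrite rmorph1 oner_neq0; split=> //; exists 0; rewrite rmorph0 mulr0.
have [a [t [t0 ha]]] := iP c.
exists (t * s); split; first by rewrite rmorphM mulf_neq0.
exists (t%:P * p' * 'X + (s * a)%:P).
rewrite rmorphD !rmorphM /= !map_polyC map_polyX hp' map_polyC /= -ha; ring.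
Qed.

End PolyDenominators.

Lemma map_poly_inj' (A B : nzRingType) (g : {rmorphism A -> B}) :
  injective g -> injective (map_poly g).
Proof.
move=> gi p q /polyP h; apply/polyP => j; apply: gi.
by have := h j; rewrite !coef_map.
Qed.

Section AffineHorrocks.
Variables (A : comNzRingType) (Om : fieldType) (io : {rmorphism A -> Om}).
Hypothesis io_inj : injective io.
Variables (N r : nat) (e : 'M[{poly A}]_N).
Hypothesis he : e *m e = e.

(** Quillen's patching ideal. Quantifying over all specializations of the two
    variables makes the closure properties immediate: for instance [e(x+cy+dy)],
    [e(x+cy)] and [e(x)] are equivalent in turn. *)
Definition translation_mvn (c : A) : Prop :=
  forall (D : comNzRingType) (h : {rmorphism A -> D}) x y,
    mvn (map_mx (subst h (x + h c * y)) e) (map_mx (subst h x) e).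

Let idem (D : comNzRingType) (h : {rmorphism A -> D}) x :
  map_mx (subst h x) e *m map_mx (subst h x) e = map_mx (subst h x) e.
Proof. by rewrite -map_mxM he. Qed.

Lemma translation0 : translation_mvn 0.
Proof.
move=> D h x y; rewrite rmorph0 mul0r addr0.
by exists (map_mx (subst h x) e), (map_mx (subst h x) e); rewrite idem.
Qed.

Lemma translationD c d :
  translation_mvn c -> translation_mvn d -> translation_mvn (c + d).
Proof.
move=> hc hd D h x y; rewrite rmorphD mulrDl addrA.
exact: mvn_trans (idem _ _) (idem _ _) (hd _ _ _ _) (hc _ _ _ _).
Qed.

Lemma translationM a c : translation_mvn c -> translation_mvn (a * c).
Proof.
by move=> hc D h x y; rewrite rmorphM mulrAC mulrC; apply: hc.
Qed.

(** Take [x = 0] and [y = 'X]. *)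
Lemma translation1 : translation_mvn 1 ->
  mvn e (map_mx polyC (map_mx (horner_eval 0) e)).
Proof.
move=> /(_ {poly A} polyC 0 'X); rewrite rmorph1 mul1r add0r.
rewrite [X in mvn X](_ : _ = e).
  rewrite [X in mvn _ X](_ : _ = map_mx polyC (map_mx (horner_eval 0) e)) //.
  apply/matrixP => i j; rewrite !mxE substE /horner_eval -horner_map.
  by rewrite rmorph0.
by apply/matrixP => i j; rewrite mxE substE -[RHS]comp_polyXr.
Qed.

(** The matrix [U(x + c y) V(x) / c] relates [e(x + c y)] to [e(x)], and it has no
    denominator: modulo [c] its numerator is [U(x) V(x) = c e(x)]. The identities
    hold in the generic case [A[x, y]], where [c] is not a zero divisor, and they
    specialize. *)
Lemma translation_local c (U : 'M_(N, r)) (V : 'M_(r, N)) : c != 0 ->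
  V *m U = (c%:P)%:M -> U *m V = c%:P *: e -> translation_mvn c.
Proof.
move=> c0 VU UV D h x y.
pose h0 : {rmorphism A -> {poly {poly A}}} := polyC \o polyC.
pose g : {rmorphism {poly {poly A}} -> D} := horner_eval y \o map_poly (subst h x).
have gh a : g (h0 a) = h a.
  by rewrite /= map_polyC /horner_eval hornerC; apply: substC.
have gX : g ('X%:P) = x by rewrite /= map_polyC /horner_eval hornerC; apply: substX.
have gY : g 'X = y by rewrite /= map_polyX /horner_eval hornerX.
pose X : {poly {poly A}} := 'X%:P; pose Y : {poly {poly A}} := 'X.
suff : mvn (map_mx (subst h0 (X + h0 c * Y)) e) (map_mx (subst h0 X) e).
  move/(mvn_map g); rewrite -!map_mx_comp.
  rewrite [X in mvn X](_ : _ = map_mx (subst h (x + h c * y)) e).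
    rewrite [X in mvn _ X](_ : _ = map_mx (subst h x) e) //.
    apply/matrixP => i j; rewrite !mxE.
    by apply: etrans (subst_comp _ _ gh) _; rewrite gX.
  apply/matrixP => i j; rewrite !mxE; apply: etrans (subst_comp _ _ gh) _.
  by rewrite rmorphD rmorphM gX gY gh.
pose C := h0 c.
have Cinj : GRing.lreg C.
  apply: lreg_lead; rewrite lead_coefC; apply: lreg_lead; rewrite lead_coefC.
  move=> a b /(congr1 io); rewrite !rmorphM => /mulfI h'; apply/io_inj/h'.
  by apply: contra c0 => /eqP c0; apply/eqP/io_inj; rewrite c0 rmorph0.
have Cmx m n (M M' : 'M_(m, n)) : C *: M = C *: M' -> M = M'.
  move=> /matrixP eM; apply/matrixP => i j; apply: Cinj.
  by have := eM i j; rewrite !mxE.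
have VUs z : map_mx (subst h0 z) V *m map_mx (subst h0 z) U = C%:M.
  by rewrite -map_mxM VU map_scalar_mx /= substC.
have UVs z : map_mx (subst h0 z) U *m map_mx (subst h0 z) V =
    C *: map_mx (subst h0 z) e.
  by rewrite -map_mxM UV map_mxZ /= substC.
have [W1 hW1] := subst_shift h0 U X C Y.
have [W2 hW2] := subst_shift h0 V X C Y.
rewrite -/C; set Uy := map_mx _ U in hW1; set Vy := map_mx _ V in hW2.
have UVy := UVs (X + C * Y); have VUy := VUs (X + C * Y).
rewrite -/Uy -/Vy in UVy VUy.
have UVx := UVs X; have VUx := VUs X.
move: (map_mx (subst h0 X) U) (map_mx (subst h0 X) V) hW1 hW2 UVx VUx UVy VUy.
move=> Ux Vx hW1 hW2 UVx VUx UVy VUy.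
pose G := map_mx (subst h0 X) e + W1 *m Vx.
pose H := map_mx (subst h0 X) e + Ux *m W2.
have CG : C *: G = Uy *m Vx.
  by rewrite hW1 mulmxDl UVx -scalemxAl scalerDr.
have CH : C *: H = Ux *m Vy.
  by rewrite hW2 mulmxDr UVx -scalemxAr scalerDr.
exists G, H; split; apply: (Cmx); apply: (Cmx).
  rewrite scalemxAr scalemxAl CG CH -mulmxA (mulmxA Vx) VUx mul_scalar_mx.
  by rewrite -scalemxAr UVy.
rewrite scalemxAr scalemxAl CG CH -mulmxA (mulmxA Vy) VUy mul_scalar_mx.
by rewrite -scalemxAr UVx.
Qed.

(** If the patching ideal were proper, Horrocks' theorem at a maximal ideal
    containing it would produce, after clearing denominators, an element of the
    patching ideal outside this maximal ideal. *)
Theorem affine_horrocks (U : 'M_(N, r)) (V : 'M_(r, N)) f :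
  e *m U = U -> V *m e = V -> V *m U = f%:M -> U *m V = f *: e ->
  f \is monic -> mvn e (map_mx polyC (map_mx (horner_eval 0) e)).
Proof.
move=> eU Ve VU UV fm; apply: translation1; apply: contrapT => n1.
have [k [res [res_surj res0]]] :=
  residue_field translation0 translationD translationM n1.
have [L [f' [i [i_inj f'i f'unit iP]]]] := localization res io_inj.
have f'surj y : exists x, f' x = y.
  by have [a <-] := res_surj y; exists (i a).
have [] := @horrocks_local _ _ f' f'surj f'unit N r (map_mx (map_poly i) e)
  (map_mx (map_poly i) U) (map_mx (map_poly i) V) (map_poly i f).
- by rewrite -map_mxM he.
- by rewrite -map_mxM eU.
- by rewrite -map_mxM Ve.
- by rewrite -map_mxM VU map_scalar_mx.
- by rewrite -map_mxM UV map_mxZ.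
- exact: monic_map.
move=> U1 [V1 [UV1 VU1]].
have clr m n := @clear_mx _ _ _ polyC (map_poly i) (fun s => res s != 0) _ _
  (clear_poly iP) m n.
have [||s [s0 [U2 hU2]]] := clr _ _ _ _ U1; first by rewrite rmorph1 oner_neq0.
  by move=> a b a0 b0; rewrite rmorphM mulf_neq0.
have [||t [t0 [V2 hV2]]] := clr _ _ _ _ V1; first by rewrite rmorph1 oner_neq0.
  by move=> a b a0 b0; rewrite rmorphM mulf_neq0.
have st0 : res (s * t) != 0 by rewrite rmorphM mulf_neq0.
have pinj := map_poly_inj' i_inj.
have stE : map_poly i (s * t)%:P = map_poly i s%:P * map_poly i t%:P.
  by rewrite polyCM rmorphM.
move/eqP: st0; apply; apply: res0; apply: (@translation_local _ U2 V2).
- by apply/eqP => st0; move: (mulf_neq0 s0 t0); rewrite -rmorphM st0 rmorph0 eqxx.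
- apply: (map_mx_inj' pinj); rewrite map_mxM hU2 hV2 -scalemxAl -scalemxAr VU1.
  by rewrite map_scalar_mx !scale_scalar_mx mulr1 mulrC -stE.
- apply: (map_mx_inj' pinj); rewrite map_mxM hU2 hV2 -scalemxAl -scalemxAr UV1.
  by rewrite map_mxZ scalerA -stE.
Qed.
End AffineHorrocks.

(** * Monoid algebras *)

Section MonoidAlgebra.
Variables (A : comPzRingType) (E : nmodType).

Lemma ma_ind (P : monoid_alg A E -> Prop) :
  P 0 -> (forall x y, P x -> P y -> P (x + y)) ->
  (forall c e, P (ma_monom c e)) -> forall x, P x.
Proof.
move=> P0 PD PU x; rewrite [x]monalgE.
by elim/big_ind: _ => // e _; apply: PU.
Qed.

Lemma ma_ext (V : zmodType) (F G : {additive monoid_alg A E -> V}) :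
  (forall c e, F (ma_monom c e) = G (ma_monom c e)) -> F =1 G.
Proof.
move=> h; apply: ma_ind => [|x y hx hy|//]; first by rewrite !raddf0.
by rewrite !raddfD hx hy.
Qed.

(** The coefficient map, typed so that it is additive on [monoid_alg]. *)
Definition ma_coef (e : E) (x : monoid_alg A E) : A := mcoeff e x.
Fact ma_coef_zmod e : zmod_morphism (ma_coef e).
Proof. by move=> x y; apply: mcoeffB. Qed.
HB.instance Definition _ e := GRing.isZmodMorphism.Build (monoid_alg A E) A
  (ma_coef e) (ma_coef_zmod e).

Lemma ma_coefP (x y : monoid_alg A E) :
  (forall e, ma_coef e x = ma_coef e y) -> x = y.
Proof. by move=> h; apply/malgP. Qed.

Lemma ma_coef_monom (c : A) (e e' : E) :
  ma_coef e' (ma_monom c e) = c *+ (e == e').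
Proof. exact: mcoeffU. Qed.

Lemma ma_monomM c1 c2 (e1 e2 : E) :
  (ma_monom c1 e1 : monoid_alg A E) * ma_monom c2 e2 = ma_monom (c1 * c2) (e1 + e2).
Proof. exact: ma_mulUU. Qed.

Lemma ma_monomX (c : A) (e : E) n :
  (ma_monom c e : monoid_alg A E) ^+ n = ma_monom (c ^+ n) (e *+ n).
Proof. by elim: n => // n IH; rewrite !exprS IH ma_monomM mulrS. Qed.

Fact ma_const_zmod : zmod_morphism (@ma_const A E).
Proof. by move=> x y; apply: monalgUB. Qed.
Fact ma_const_monoid : GRing.monoid_morphism (@ma_const A E).
Proof. by split=> // x y; rewrite /ma_const ma_monomM addr0. Qed.

HB.instance Definition _ := GRing.isZmodMorphism.Build A (monoid_alg A E)
  (@ma_const A E) ma_const_zmod.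
HB.instance Definition _ := GRing.isMonoidMorphism.Build A (monoid_alg A E)
  (@ma_const A E) ma_const_monoid.

Lemma ma_monomE (c : A) (e : E) :
  ma_monom c e = ma_const E c * (ma_monom 1 e : monoid_alg A E).
Proof. by rewrite /ma_const ma_monomM mulr1 add0r. Qed.

Section Eval.
Variables (C : comPzRingType) (h : {rmorphism A -> C}) (chi : E -> C).
Hypotheses (chi0 : chi 0 = 1) (chiD : forall a b, chi (a + b) = chi a * chi b).

Let ev (x : monoid_alg A E) : C := \sum_(e <- msupp x) h (mcoeff e x) * chi e.

Let evw (d : {fset E}) (x : monoid_alg A E) : fsubset (msupp x) d ->
  ev x = \sum_(e <- d) h (mcoeff e x) * chi e.
Proof.
move=> hd; rewrite /ev (big_fset_incl _ hd) //= => e _ /mcoeff_outdom ->.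
by rewrite rmorph0 mul0r.
Qed.

(** The universal property of the monoid algebra. *)
Lemma ma_eval : exists F : {rmorphism monoid_alg A E -> C},
  forall c e, F (ma_monom c e) = h c * chi e.
Proof.
have evU c e : ev (ma_monom c e) = h c * chi e.
  by rewrite (evw msuppU_le) big_seq_fset1 mcoeffUU.
have evB : zmod_morphism ev.
  move=> x y; rewrite (evw (msuppB_le x y)).
  rewrite (evw (fsubsetUl (msupp x) (msupp y))).
  rewrite (evw (fsubsetUr (msupp x) (msupp y))).
  by rewrite -sumrB; apply: eq_bigr => e _; rewrite mcoeffB rmorphB mulrBl.
pose evA : {additive monoid_alg A E -> C} :=
  HB.pack ev (GRing.isZmodMorphism.Build _ _ ev evB).
have evM : GRing.monoid_morphism ev.
  split; first by rewrite -[1]/(ma_monom 1 0) evU rmorph1 chi0 mulr1.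
  have evD x y : ev (x + y) = ev x + ev y by exact: (raddfD evA).
  have ev0 : ev 0 = 0 by exact: (raddf0 evA).
  move=> x y; elim/ma_ind: x => [|x1 x2 h1 h2|c e].
  - by rewrite mul0r ev0 mul0r.
  - by rewrite mulrDl !evD h1 h2 mulrDl.
  - elim/ma_ind: y => [|y1 y2 h1 h2|c' e'].
    + by rewrite mulr0 ev0 mulr0.
    + by rewrite mulrDr !evD h1 h2 mulrDr.
    + by rewrite ma_monomM !evU chiD rmorphM mulrACA.
pose evR : {rmorphism monoid_alg A E -> C} := HB.pack ev
  (GRing.isZmodMorphism.Build _ _ ev evB) (GRing.isMonoidMorphism.Build _ _ ev evM).
by exists evR.
Qed.
End Eval.
End MonoidAlgebra.

Section MonoidAlgebraNz.
Variables (A : comNzRingType) (E : nmodType).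
Fact ma_oner_neq0 : (1 : monoid_alg A E) != 0.
Proof.
apply/eqP => /(congr1 (mcoeff 0)); rewrite mcoeff0 mcoeffUU => /eqP.
by rewrite oner_eq0.
Qed.
HB.instance Definition _ :=
  GRing.PzSemiRing_isNonZero.Build (monoid_alg A E) ma_oner_neq0.
End MonoidAlgebraNz.

Lemma ma_map_coef (A B : comPzRingType) (E : nmodType) (g : {rmorphism A -> B}) :
  exists F : {rmorphism monoid_alg A E -> monoid_alg B E},
    (forall c e, F (ma_monom c e) = ma_monom (g c) e) /\
    forall x e, ma_coef e (F x) = g (ma_coef e x).
Proof.
have [|e e'|F hF] := @ma_eval A E _ (ma_const E \o g : {rmorphism _ -> _})
  (fun e => ma_monom 1 e).
- by [].
- by rewrite ma_monomM mulr1.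
have FU c e : F (ma_monom c e) = ma_monom (g c) e by rewrite hF /= -ma_monomE.
exists F; split=> // x e.
have := @ma_ext A E B (ma_coef e \o F : {additive _ -> _})
  (g \o ma_coef e : {additive _ -> _}).
by apply=> c e'; rewrite /= FU !ma_coef_monom rmorphMn.
Qed.

Lemma ma_map_exp (A : comPzRingType) (E E' : nmodType) (s : E -> E') :
  s 0 = 0 -> (forall a b, s (a + b) = s a + s b) ->
  exists F : {rmorphism monoid_alg A E -> monoid_alg A E'},
    (forall c e, F (ma_monom c e) = ma_monom c (s e)) /\
    (injective s -> injective F).
Proof.
move=> s0 sD.
have [|e e'|F hF] := @ma_eval A E _ (@ma_const A E' : {rmorphism _ -> _})
  (fun e => ma_monom 1 (s e)).
- by rewrite s0.
- by rewrite ma_monomM mulr1 sD.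
have FU c e : F (ma_monom c e) = ma_monom c (s e) by rewrite hF /= -ma_monomE.
exists F; split=> // si; apply: raddf_inj => x Fx0; apply: ma_coefP => e.
suff <- : ma_coef (s e) (F x) = ma_coef e x by rewrite Fx0 !raddf0.
have := @ma_ext A E A (ma_coef (s e) \o F : {additive _ -> _})
  (ma_coef e : {additive _ -> _}).
by apply=> c e'; rewrite /= FU !ma_coef_monom (inj_eq si).
Qed.

Section PolynomialVariable.
Variables (A : comNzRingType) (E : nmodType).

(** A new variable can be read as an outer polynomial variable; see
    [ma_of_polycoef] for the other reading, where it joins the coefficients. *)
Lemma ma_to_poly :
  exists b : {rmorphism monoid_alg A (E * nat)%type -> {poly monoid_alg A E}},
  [/\ forall c e i, b (ma_monom c (e, i)) = (ma_monom c e)%:P * 'X^i,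
      injective b & forall y, exists x, b x = y].
Proof.
have [|e e'|b hb] := @ma_eval A (E * nat)%type _
    (polyC \o @ma_const A E : {rmorphism _ -> {poly monoid_alg A E}})
    (fun ei => (ma_monom 1 ei.1)%:P * 'X^(ei.2)).
- by rewrite expr0 mulr1.
- have -> : (ma_monom 1 (e + e').1 : monoid_alg A E) =
      ma_monom 1 e.1 * ma_monom 1 e'.1.
    by rewrite ma_monomM mulr1.
  by rewrite (_ : (e + e').2 = (e.2 + e'.2)%N) // exprD polyCM mulrACA.
have bU c e i : b (ma_monom c (e, i)) = (ma_monom c e)%:P * 'X^i.
  by rewrite hb /= mulrA -polyCM -ma_monomE.
exists b; split=> //.
  apply: raddf_inj => x bx0; apply: ma_coefP => -[e i].
  suff <- : ma_coef e (coefp i (b x)) = ma_coef (e, i) x by rewrite bx0 !raddf0.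
  have := @ma_ext A _ A (ma_coef e \o (coefp i \o b) : {additive _ -> _})
    (ma_coef (e, i) : {additive _ -> _}).
  apply=> c [e' i']; rewrite [LHS]/= bU mul_polyC /coefp coefZ coefXn.
  rewrite [RHS](_ : _ = c *+ ((e', i') == (e, i))); last exact: ma_coef_monom.
  rewrite xpair_eqE [i == i']eq_sym.
  by case: (i' == i); rewrite ?andbT ?mulr1 ?mulr0 ?raddf0 ?andbF // ma_coef_monom.
elim/poly_ind => [|p y [x <-]]; first by exists 0; rewrite raddf0.
have [z hz] : exists z, b z = y%:P.
  elim/ma_ind: y => [|y1 y2 [z1 h1] [z2 h2]|c e].
  - by exists 0; rewrite !raddf0.
  - by exists (z1 + z2); rewrite rmorphD h1 h2 polyCD.
  - by exists (ma_monom c (e, 0%N)); rewrite bU mulr1.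
exists (x * ma_monom 1 (0, 1%N) + z).
by rewrite rmorphD rmorphM bU expr1 mul1r hz.
Qed.

Lemma ma_of_polycoef :
  exists l : {rmorphism monoid_alg {poly A} E -> monoid_alg A (E * nat)%type},
   (forall c e i, l (ma_monom (c *: 'X^i) e) = ma_monom c (e, i)) /\
   forall y, exists x, l x = y.
Proof.
pose t : monoid_alg A (E * nat)%type := ma_monom 1 (0, 1%N).
pose h : {rmorphism {poly A} -> monoid_alg A (E * nat)%type} :=
  horner_eval t \o map_poly (@ma_const A (E * nat)%type).
have [|e e'|l hl] := @ma_eval {poly A} E _ h (fun e => ma_monom 1 (e, 0%N)).
- by [].
- by rewrite ma_monomM mulr1.
have lU c e i : l (ma_monom (c *: 'X^i) e) = ma_monom c (e, i).
  rewrite hl /= /horner_eval -mul_polyC rmorphM /= map_polyC map_polyXn.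
  rewrite hornerM hornerC hornerXn.
  rewrite ma_monomX expr1n !ma_monomM !mulr1; congr ma_monom.
  rewrite !add0r; have -> : ((0, 1%N) : (E * nat)%type) *+ i = (0, i).
    elim: i => // i IH; rewrite mulrS IH.
    by congr pair; rewrite /= add0r.
  by congr pair; [exact: add0r|exact: addn0].
exists l; split=> //; elim/ma_ind => [|y1 y2 [z1 h1] [z2 h2]|c [e i]].
- by exists 0; rewrite !raddf0.
- by exists (z1 + z2); rewrite rmorphD h1 h2.
- by exists (ma_monom (c *: 'X^i) e).
Qed.

Lemma ma_ext_polycoef (V : zmodType) (F G : {additive monoid_alg {poly A} E -> V}) :
  (forall c e i, F (ma_monom (c *: 'X^i) e) = G (ma_monom (c *: 'X^i) e)) -> F =1 G.
Proof.
move=> h; apply: ma_ext => p e.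
rewrite -[p]coefK poly_def.
have -> : ma_monom (\sum_(i < size p) p`_i *: 'X^i) e =
    \sum_(i < size p) ma_monom (p`_i *: 'X^i) e :> monoid_alg _ _.
  by apply: (big_morph (fun p => ma_monom p e) (monalgUD e) (monalgU0 e)).
by rewrite !raddf_sum; apply: eq_bigr => i _; apply: h.
Qed.
End PolynomialVariable.

Local Notation "x %:F" := (@FracField.tofrac _ x).

Lemma fraction_clear (R : idomainType) (x : {fraction R}) :
  exists s, s != 0 /\ exists y, y%:F = s%:F * x.
Proof.
elim/quotW: x => r; exists (\d_r); split; first exact: denom_ratioP.
exists (\n_r); unlock FracField.tofrac.
rewrite -[RHS]FracField.pi_mul /FracField.mulf.
apply/eqmodP; rewrite /= FracField.equivfE.
rewrite !numden_Ratio ?(oner_neq0, mul1r, mulr1, denom_ratioP) //.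
by rewrite mulrC.
Qed.

(** Here [F] plays the role of [k(t)], and [C] is [k[E][t]] or [k[E][t, 1/t]]. *)
Section GenericSplitting.
Variables (k : fieldType) (E : nmodType) (C : comPzRingType).
Variables (F : fieldType) (fr : {rmorphism {poly k} -> F}).
Hypothesis fr_clear : forall x, exists s, s != 0 /\ exists y, fr y = fr s * x.
Variables (inc : {rmorphism monoid_alg {poly k} E -> monoid_alg F E}).
Hypothesis incU : forall c e, inc (ma_monom c e) = ma_monom (fr c) e.
Variables (la : {rmorphism monoid_alg {poly k} E -> C}).
Variables (th : {rmorphism C -> monoid_alg F E}).
Hypotheses (thla : forall x, th (la x) = inc x) (th_inj : injective th).
Hypothesis freeF : idem_free (monoid_alg F E).

Lemma inc_clear x : exists s : {poly k}, s != 0 /\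
  exists y, inc y = inc (ma_const E s) * x.
Proof.
elim/ma_ind: x => [|x1 x2 [s1 [s10 [y1 h1]]] [s2 [s20 [y2 h2]]]|c e].
- by exists 1; rewrite oner_neq0; split=> //; exists 0; rewrite rmorph0 mulr0.
- exists (s1 * s2); rewrite mulf_neq0 //; split=> //.
  exists (ma_const E s2 * y1 + ma_const E s1 * y2).
  rewrite rmorphD !rmorphM h1 h2 mulrDr.
  move: (inc (ma_const E s1)) (inc (ma_const E s2)) => a b.
  by rewrite !mulrA [b * a]mulrC.
- have [s [s0 [y hy]]] := fr_clear c; exists s; split=> //.
  by exists (ma_monom y e); rewrite !incU hy ma_monomM add0r.
Qed.

(** Factor [e] over [F[E]] and clear the denominators of both factors. *)
Lemma generic_splitting N (e : 'M[C]_N) : e *m e = e ->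
  exists r (U : 'M_(N, r)) (V : 'M_(r, N)) (g : {poly k}),
    [/\ g \is monic, e *m U = U, V *m e = V,
        V *m U = (la (ma_const E g))%:M & U *m V = la (ma_const E g) *: e].
Proof.
move=> he; have [|r [U0 [V0 [h1 h2]]]] := freeF (e := map_mx th e).
  by rewrite -map_mxM he.
have clr m n := @clear_mx _ _ _ (@ma_const _ E) inc (fun s => s != 0) (oner_neq0 _)
  _ inc_clear m n.
have [|s [s0 [U hU]]] := clr _ _ _ U0; first by move=> a b a0 b0; rewrite mulf_neq0.
have [|t [t0 [V hV]]] := clr _ _ _ V0; first by move=> a b a0 b0; rewrite mulf_neq0.
have thm m n (M : 'M_(m, n)) : map_mx th (map_mx la M) = map_mx inc M.
  by apply/matrixP => i j; rewrite !mxE thla.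
pose c := (lead_coef (s * t))^-1.
have lc0 : lead_coef (s * t) != 0 by rewrite lead_coef_eq0 mulf_neq0.
exists r, (la (ma_const E c%:P) *: map_mx la U), (map_mx la V), (c *: (s * t)).
have inj m n : injective (@map_mx _ _ th m n) by apply: map_mx_inj'.
have e0 : map_mx th e *m U0 = U0 by rewrite -h1 -mulmxA h2 mulmx1.
have e1 : V0 *m map_mx th e = V0 by rewrite -h1 mulmxA h2 mul1mx.
have gE : la (ma_const E (c *: (s * t))) =
    la (ma_const E c%:P) * (la (ma_const E s) * la (ma_const E t)).
  by rewrite -mul_polyC !rmorphM.
split.
- by rewrite monicE lead_coefZ mulVf.
- rewrite -scalemxAr; congr (_ *: _); apply: inj.
  by rewrite map_mxM thm hU -scalemxAr e0.
- by apply: inj; rewrite map_mxM thm hV -scalemxAl e1.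
- rewrite gE -scalemxAr -scale_scalar_mx; congr (_ *: _); apply: inj.
  rewrite map_mxM !thm hU hV map_scalar_mx -scalemxAl -scalemxAr h2.
  by rewrite !scale_scalar_mx mulr1 [LHS]/= rmorphM !thla mulrC.
- rewrite gE -scalemxAl -scalerA; congr (_ *: _); apply: inj.
  rewrite map_mxM !thm hU hV map_mxZ -scalemxAl -scalemxAr h1 scalerA.
  by rewrite rmorphM !thla.
Qed.
End GenericSplitting.

Lemma rational_functions (k : fieldType) :
  exists (F : fieldType) (fr : {rmorphism {poly k} -> F}), injective fr /\
    forall x, exists s, s != 0 /\ exists y, fr y = fr s * x.
Proof.
exists {fraction {poly k}}, (@FracField.tofrac _); split; last exact: fraction_clear.
by move=> a b /eqP; rewrite tofrac_eq => /eqP.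
Qed.

Section LaurentVariable.
Variables (k : fieldType) (E : nmodType).

Lemma shift_to_poly
  (j : {rmorphism monoid_alg k (E * nat)%type -> monoid_alg k (E * int)%type}) :
  (forall c e (i : nat), j (ma_monom c (e, i)) = ma_monom c (e, i%:Z)) ->
  forall x, exists M : nat, exists b, j b = ma_monom 1 (0, M%:Z) * x.
Proof.
move=> jU; elim/ma_ind => [|x1 x2 [m [b hb]] [n [d hd]]|c [e i]].
- by exists 0%N, 0; rewrite rmorph0 mulr0.
- exists (m + n)%N, (ma_monom 1 (0, n) * b + ma_monom 1 (0, m) * d).
  have -> : ma_monom 1 (0, (m + n)%N%:Z) =
      ma_monom 1 (0, n%:Z) * ma_monom 1 (0, m%:Z) :> monoid_alg k (E * int)%type.
    rewrite ma_monomM mulr1; congr ma_monom; congr pair; first by rewrite /= addr0.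
    by rewrite PoszD addrC.
  rewrite rmorphD !rmorphM hb hd !jU.
  move: (ma_monom 1 (0, n%:Z)) (ma_monom 1 (0, m%:Z)) => u v.
  by rewrite mulrDr !mulrA [v * u]mulrC.
- pose m := absz (i : int); exists m, (ma_monom c (e, absz ((i : int) + m%:Z))).
  rewrite jU ma_monomM mul1r; congr ma_monom; congr pair; rewrite /= ?add0r //.
  have lem (z : int) : `|z + `|z|%:Z|%:Z = `|z|%:Z + z by lia.
  exact: lem.
Qed.

(** The rings in play are
      [k[t][E] = k[E][t] -> k[E][t, 1/t] -> k(t)[E]],
    the maps being [la], [j] and [th], with composite [inc]. The injectivity of
    [th] follows from that of [inc] since a power of [t] sends any element into
    the image of [j]. *)
Lemma laurent_setup : exists (F : fieldType) (fr : {rmorphism {poly k} -> F})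
  (inc : {rmorphism monoid_alg {poly k} E -> monoid_alg F E})
  (la : {rmorphism monoid_alg {poly k} E -> monoid_alg k (E * nat)%type})
  (j : {rmorphism monoid_alg k (E * nat)%type -> monoid_alg k (E * int)%type})
  (th : {rmorphism monoid_alg k (E * int)%type -> monoid_alg F E}),
  [/\ forall x, exists s, s != 0 /\ exists y, fr y = fr s * x,
      forall c e, inc (ma_monom c e) = ma_monom (fr c) e,
      (forall c e i, la (ma_monom (c *: 'X^i) e) = ma_monom c (e, i)) /\
        forall y, exists x, la x = y,
      (forall c e (i : nat), j (ma_monom c (e, i)) = ma_monom c (e, i%:Z)) /\
        injective j &
      (forall x, th (j (la x)) = inc x) /\ injective th].
Proof.
have [F [fr [fr_inj fr_clear]]] := rational_functions k.
have [inc [incU incC]] := ma_map_coef E fr.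
have [la [laU la_surj]] := ma_of_polycoef k E.
have [||j [jU j_inj]] := @ma_map_exp k _ (E * int)%type
  (fun ei : (E * nat)%type => (ei.1, ei.2%:Z)) => //.
have {}jU c e i : j (ma_monom c (e, i)) = ma_monom c (e, i%:Z) by exact: jU.
have {}j_inj : injective j by apply: j_inj => -[e i] [e' i'] [-> ->].
pose t := fr 'X; have t0 : t != 0.
  apply/eqP => t0; have := @fr_inj 'X 0; rewrite rmorph0 => /(_ t0)/eqP.
  by rewrite polyX_eq0.
have [|e e'|th thU] := @ma_eval k (E * int)%type (monoid_alg F E)
  (@ma_const F E \o (fr \o polyC) : {rmorphism _ -> _})
  (fun ei => ma_monom (t ^ ei.2) ei.1).
- by [].
- by rewrite ma_monomM -expfzDr.
have thj x : th (j (la x)) = inc x.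
  have := @ma_ext_polycoef k E _ (th \o (j \o la) : {additive _ -> _})
    (inc : {additive _ -> _}).
  apply=> c e i; apply: etrans (esym (incU _ _)).
  rewrite [LHS]/= laU jU thU ma_monomM add0r.
  by rewrite -mul_polyC rmorphM rmorphXn.
exists F, fr, inc, la, j, th; split=> //; split=> //.
apply: raddf_inj => x thx0.
have [M [b hb]] := shift_to_poly jU x; have [y hy] := la_surj b.
have y0 : y = 0.
  apply: ma_coefP => e; apply: fr_inj; rewrite -incC -thj hy hb rmorphM thx0 mulr0.
  by rewrite !raddf0.
have tV : 1 = ma_monom 1 (0, - M%:Z) * ma_monom 1 (0, M%:Z)
    :> monoid_alg k (E * int)%type.
  rewrite ma_monomM mulr1; congr ma_monom.
  by congr pair; rewrite /= ?addr0 // addNr.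
rewrite -[x]mul1r tV.
by rewrite -mulrA -hb -hy y0 !rmorph0 mulr0.
Qed.
End LaurentVariable.

Section Adjoin.
Variables (k : fieldType) (E : nmodType).
Hypothesis freeE : forall F : fieldType, idem_free (monoid_alg F E).

(** The module is extended from [k[E]] by [affine_horrocks], since the
    denominator [g] of [generic_splitting] is a monic polynomial in the new
    variable. *)
Theorem idem_free_adjoin_nat (Om : fieldType)
    (io : {rmorphism monoid_alg k E -> Om}) :
  injective io -> idem_free (monoid_alg k (E * nat)%type).
Proof.
move=> io_inj N e he.
have [F [fr [inc [la [j [th [fr_clear incU [laU la_surj] [jU j_inj]
  [thla th_inj]]]]]]]] := laurent_setup k E.
have [|r [U [V [g [gm eU Ve VU UV]]]]] := generic_splitting fr_clear incU
   (la := la) (th := th \o j : {rmorphism _ -> _}) thla _ (freeE (F := F)) he.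
  exact: inj_comp.
have [b [bU b_inj b_surj]] := ma_to_poly k E.
have bg : b (la (ma_const E g)) = map_poly (@ma_const k E) g.
  have mp c i : map_poly (@ma_const k E) (c *: 'X^i) = (ma_const E c)%:P * 'X^i.
    by rewrite -mul_polyC rmorphM /= map_polyC map_polyXn.
  rewrite -[g]coefK poly_def !raddf_sum; apply: eq_bigr => i _.
  rewrite [LHS](_ : _ = b (ma_monom g`_i (0, i : nat))); last first.
    by congr (b _); apply: laU.
  by rewrite bU; apply: esym; apply: mp.
have hbe : map_mx b e *m map_mx b e = map_mx b e by rewrite -map_mxM he.
have h1 : mvn (map_mx b e) (map_mx polyC (map_mx (horner_eval 0) (map_mx b e))).
  apply: (@affine_horrocks _ _ io io_inj N r _ hbe (map_mx b U) (map_mx b V)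
    (b (la (ma_const E g)))).
  - by rewrite -map_mxM eU.
  - by rewrite -map_mxM Ve.
  - by rewrite -map_mxM VU map_scalar_mx.
  - by rewrite -map_mxM UV map_mxZ.
  - by rewrite bg monic_map.
have [|r' h2] := freeE (e := map_mx (horner_eval 0) (map_mx b e)).
  by rewrite -map_mxM hbe.
exists r'; apply: (mvn_bij b_inj b_surj).
apply: mvn_trans hbe _ h1 _; first by rewrite mulmx1.
by have := mvn_map (@polyC _ : {rmorphism _ -> _}) h2; rewrite map_mx1.
Qed.

(** Glue the image of [e] on the open set [t <> 0] with a free module on the open
    set [g <> 0]. The glued module over [k[E][t]] is the submodule of
    [k[E][t]_g ^ r] spanned by the unit vectors and the columns of [t^M V / g];
    the functionals [g] and [t^M U] on it, with the Bezout coefficients of [g]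
    and [t^(2M)], present it as the image of the block matrix [eB]. *)
Theorem idem_free_adjoin_int :
  idem_free (monoid_alg k (E * nat)%type) -> idem_free (monoid_alg k (E * int)%type).
Proof.
move=> freeB N e he.
have [F [fr [inc [la [j [th [fr_clear incU [laU la_surj] [jU j_inj]
  [thla th_inj]]]]]]]] := laurent_setup k E.
have [r [U [V [g [gm eU Ve VU UV]]]]] := generic_splitting fr_clear incU
   (la := j \o la : {rmorphism _ -> _}) (th := th) thla th_inj (freeE (F := F)) he.
pose T : {rmorphism {poly k} -> monoid_alg k (E * nat)%type} :=
  la \o @ma_const {poly k} E.
have TX n : T 'X^n = ma_monom 1 (0, n).
  by rewrite -laU scale1r.
pose tau (n : nat) : monoid_alg k (E * int)%type := ma_monom 1 (0, n%:Z).
have jT n : j (T 'X^n) = tau n by rewrite TX jU.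
have tauD m n : tau (m + n)%N = tau m * tau n by rewrite -!jT exprD !rmorphM.
have clear x : exists s, (exists n, s = 'X^n) /\ exists y, j y = j (T s) * x.
  have [M [y hy]] := shift_to_poly jU x; exists ('X^M); split; first by exists M.
  by exists y; rewrite hy jT.
(* Powers of [t] are invertible, so that [g] can be made prime to [t]. *)
have [a [g' [g'0 gE]]] : exists a g', coprimep g' 'X /\ g = g' * 'X^a.
  have [a [q + ->]] := multiplicity_XsubC g 0; rewrite monic_neq0 //= => q0.
  by exists a, q; rewrite coprimepX q0 subr0.
have [ti tiP] : exists ti, ti * tau a = 1.
  exists (ma_monom 1 (0, - a%:Z)); rewrite ma_monomM mulr1; congr ma_monom.
  by congr pair; [rewrite /= addr0|exact: addNr].
pose U' := ti *: U; pose phi := j (T g').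
have laE : (j \o la) (ma_const E g) = phi * tau a by rewrite gE -jT /phi -!rmorphM.
have {}VU : V *m U = (phi * tau a)%:M by rewrite VU -laE.
have {}UV : U *m V = (phi * tau a) *: e by rewrite UV -laE.
clear laE; clearbody tau T.
have eU' : e *m U' = U' by rewrite -scalemxAr eU.
have VU' : V *m U' = phi%:M.
  by rewrite -scalemxAr VU scale_scalar_mx mulrCA tiP mulr1.
have UV' : U' *m V = phi *: e.
  by rewrite -scalemxAl UV scalerA mulrCA tiP mulr1.
clearbody U'.
have clr m n := @clear_mx _ _ _ T j (fun s => exists n, s = 'X^n)
  (ex_intro _ 0%N erefl) _ clear m n.
have XM (s t : {poly k}) : (exists n, s = 'X^n) -> (exists n, t = 'X^n) ->
    exists n, s * t = 'X^n.
  by move=> [m ->] [n ->]; exists (m + n)%N; rewrite exprD.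
have [_ [[n1 ->] [U1 hU1]]] := clr XM _ _ U'.
have [_ [[n2 ->] [V1 hV1]]] := clr XM _ _ V.
have [_ [[n3 ->] [e1 he1]]] := clr XM _ _ e.
rewrite !jT in hU1 hV1 he1.
pose M := (n1 + n2 + n3)%N.
have lift m n (X : 'M_(m, n)) a' X1 b' :
    map_mx j X1 = tau a' *: X -> (a' <= b')%N -> exists X2, map_mx j X2 = tau b' *: X.
  move=> h le; exists (T 'X^(b' - a') *: X1).
  by rewrite map_mxZ h jT scalerA -tauD subnK.
have [U2 hU2] := lift _ _ _ _ _ M hU1 ltac:(lia).
have [V2 hV2] := lift _ _ _ _ _ M hV1 ltac:(lia).
have [e2 he2] := lift _ _ _ _ _ (M + M)%N he1 ltac:(lia).
have [[u v] /= uv] := Bezout_eq1_coprimepP _ _ (coprimep_expr (M + M) g'0).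
have bez : j (T u) * phi + j (T v) * (tau M * tau M) = 1.
  by rewrite -tauD -jT /phi -!rmorphM -!rmorphD uv !rmorph1.
pose G : 'M_(N, r + N) := row_mx (j (T u) *: U') ((j (T v) * tau M) *: e).
pose H : 'M_(r + N, N) := col_mx V (tau M *: e).
pose eB := block_mx (T u * T g')%:M (T v *: V2) (T u *: U2) (T v *: e2).
have GH : G *m H = e.
  rewrite mul_row_col -!scalemxAl -!scalemxAr UV' he !scalerA -scalerDl.
  by rewrite -mulrA bez scale1r.
have HG : H *m G = map_mx j eB.
  rewrite map_block_mx map_scalar_mx !map_mxZ hU2 hV2 he2 mul_col_row.
  rewrite -!scalemxAl -!scalemxAr eU' VU' Ve he scale_scalar_mx rmorphM !scalerA.
  by rewrite tauD [j (T u) * tau M]mulrC mulrCA.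
have He : H *m e = H by rewrite mul_col_mx Ve -scalemxAl he.
clearbody G H eB.
have heB : eB *m eB = eB.
  apply: (map_mx_inj' j_inj); rewrite map_mxM -HG.
  by rewrite mulmxA -(mulmxA H G H) GH He.
have [r' h2] := freeB _ _ heB; exists r'.
have h3 : mvn (map_mx j eB) (1%:M : 'M_r') by have := mvn_map j h2; rewrite map_mx1.
apply: (mvn_trans he _ _ h3); first by rewrite mulmx1.
by exists G, H.
Qed.
End Adjoin.

(** * Polynomial and Laurent polynomial rings over a field *)

Section ExponentBijection.
Variables (A : comPzRingType) (E E' : nmodType) (s : E -> E') (t : E' -> E).
Hypotheses (s0 : s 0 = 0) (sD : forall a b, s (a + b) = s a + s b).
Hypotheses (sK : cancel s t) (tK : cancel t s).

Lemma ma_exp_bij : exists F : {rmorphism monoid_alg A E -> monoid_alg A E'},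
  injective F /\ forall y, exists x, F x = y.
Proof.
have [F [FU Fi]] := @ma_map_exp A E E' s s0 sD.
exists F; split; first exact/Fi/(can_inj sK).
elim/ma_ind => [|y1 y2 [z1 h1] [z2 h2]|c e].
- by exists 0; rewrite rmorph0.
- by exists (z1 + z2); rewrite rmorphD h1 h2.
- by exists (ma_monom c (t e)); rewrite FU tK.
Qed.

Lemma exp_inv_additive : t 0 = 0 /\ forall a b, t (a + b) = t a + t b.
Proof.
split; first by rewrite -s0 sK.
by move=> a b; apply: (can_inj sK); rewrite sD !tK.
Qed.
End ExponentBijection.

(** [affine_horrocks] requires its coefficient ring to embed in a field. *)
Definition embeds (R : comPzRingType) : Prop :=
  exists (Om : fieldType) (io : {rmorphism R -> Om}), injective io.

Lemma embeds_adjoin (k : fieldType) (E : nmodType) :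
  embeds (monoid_alg k E) -> embeds (monoid_alg k (E * nat)%type).
Proof.
move=> [Om [io io_inj]].
have [b [_ b_inj _]] := ma_to_poly k E.
have [F [fr [fr_inj _]]] := rational_functions Om.
exists F, (fr \o (map_poly io \o b) : {rmorphism _ -> _}).
by apply: inj_comp => //; apply: inj_comp => //; apply: map_poly_inj'.
Qed.

(** Exponents of [a] polynomial variables and [s] Laurent variables. *)
Definition lexp (a s : nat) : nmodType :=
  ({ffun 'I_a -> nat} * {ffun 'I_s -> int})%type.

Section Split.
Variables (T : nmodType) (n : nat).

Definition ffun_split (u : {ffun 'I_n.+1 -> T}) : ({ffun 'I_n -> T} * T)%type :=
  ([ffun i => u (lift ord0 i)], u ord0).
Definition ffun_join (ut : ({ffun 'I_n -> T} * T)%type) : {ffun 'I_n.+1 -> T} :=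
  [ffun i => if unlift ord0 i is Some j then ut.1 j else ut.2].

Lemma ffun_splitK : cancel ffun_split ffun_join.
Proof.
move=> u; apply/ffunP => i; rewrite ffunE.
by case: unliftP => [j|] -> //=; rewrite ffunE.
Qed.

Lemma ffun_joinK : cancel ffun_join ffun_split.
Proof.
move=> [u t]; congr pair; last by rewrite ffunE unlift_none.
by apply/ffunP => i; rewrite !ffunE liftK.
Qed.

Lemma ffun_split0 : ffun_split 0 = 0.
Proof. by congr pair; rewrite ?ffunE //; apply/ffunP => i; rewrite !ffunE. Qed.

Lemma ffun_splitD u v : ffun_split (u + v) = ffun_split u + ffun_split v.
Proof. by congr pair; rewrite ?ffunE //; apply/ffunP => i; rewrite !ffunE. Qed.
End Split.

Section Exponents.
Variables (a s : nat).

Definition nat_split (e : lexp a.+1 s) : (lexp a s * nat)%type :=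
  let ut := ffun_split e.1 in ((ut.1, e.2), ut.2).
Definition nat_join (x : (lexp a s * nat)%type) : lexp a.+1 s :=
  (ffun_join (x.1.1, x.2), x.1.2).
Definition int_split (e : lexp a s.+1) : (lexp a s * int)%type :=
  let ut := ffun_split e.2 in ((e.1, ut.1), ut.2).
Definition int_join (x : (lexp a s * int)%type) : lexp a s.+1 :=
  (x.1.1, ffun_join (x.1.2, x.2)).

Lemma nat_splitK : cancel nat_split nat_join.
Proof. by move=> [u v]; congr pair; rewrite -[RHS]ffun_splitK. Qed.
Lemma nat_joinK : cancel nat_join nat_split.
Proof. by move=> [[u v] w]; rewrite /nat_split ffun_joinK. Qed.
Lemma int_splitK : cancel int_split int_join.
Proof. by move=> [u v]; congr pair; rewrite -[RHS]ffun_splitK. Qed.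
Lemma int_joinK : cancel int_join int_split.
Proof. by move=> [[u v] w]; rewrite /int_split ffun_joinK. Qed.

Lemma nat_split0 : nat_split 0 = 0.
Proof. by rewrite /nat_split ffun_split0. Qed.
Lemma nat_splitD x y : nat_split (x + y) = nat_split x + nat_split y.
Proof. by rewrite /nat_split ffun_splitD. Qed.
Lemma int_split0 : int_split 0 = 0.
Proof. by rewrite /int_split ffun_split0. Qed.
Lemma int_splitD x y : int_split (x + y) = int_split x + int_split y.
Proof. by rewrite /int_split ffun_splitD. Qed.
End Exponents.

(** The case without Laurent variables. The embedding in a field is carried along
    by the induction, because [idem_free_adjoin_nat] needs it for the previous
    variables. *)
Lemma quillen_suslin_embeds a (k : fieldType) :
  embeds (monoid_alg k (lexp a 0)) /\ idem_free (monoid_alg k (lexp a 0)).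
Proof.
elim: a k => [|a IH] k.
  have lexp0 (e : lexp 0 0) : e = 0.
    by case: e => u v; congr pair; apply/ffunP => -[].
  have [//||F FU] := @ma_eval k (lexp 0 0) k idfun (fun=> 1).
    by move=> *; rewrite mulr1.
  have FC c : F (ma_const _ c) = c by rewrite FU mulr1.
  have Fi : injective F.
    suff xE x : x = ma_const _ (F x) by move=> x y e; rewrite (xE x) e -xE.
    elim/ma_ind: x => [|x y hx hy|c e]; first by rewrite !rmorph0.
      by rewrite {1}hx {1}hy rmorphD; apply: esym; apply: rmorphD.
    by rewrite FU mulr1 (lexp0 e).
  split; first by exists k, F.
  by apply: (idem_free_bij Fi _ (@idem_free_field k)) => c; exists (ma_const _ c).
have [F [Fi Fs]] := ma_exp_bij k (@nat_split0 a 0) (@nat_splitD a 0)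
  (@nat_splitK a 0) (@nat_joinK a 0).
have [emb _] := IH k; split.
  have [Om [io io_inj]] := embeds_adjoin emb.
  by exists Om, (io \o F : {rmorphism _ -> _}); apply: inj_comp.
apply: (idem_free_bij Fi Fs); have [Om [io io_inj]] := emb.
by apply: (idem_free_adjoin_nat _ io_inj) => F'; case: (IH F').
Qed.

(** Each Laurent variable is traded for a polynomial one, whence the induction on
    [s] for all [a]. *)
Theorem quillen_suslin_laurent a s (k : fieldType) :
  idem_free (monoid_alg k (lexp a s)).
Proof.
elim: s a k => [|s IH] a k; first by case: (quillen_suslin_embeds a k).
have [F [Fi Fs]] := ma_exp_bij k (@int_split0 a s) (@int_splitD a s)
  (@int_splitK a s) (@int_joinK a s).
apply: (idem_free_bij Fi Fs); apply: idem_free_adjoin_int => [F'|]; first exact: IH.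
have [t0 tD] := exp_inv_additive (@nat_split0 a s) (@nat_splitD a s)
  (@nat_splitK a s) (@nat_joinK a s).
have [G [Gi Gs]] := ma_exp_bij k t0 tD (@nat_joinK a s) (@nat_splitK a s).
exact: (idem_free_bij Gi Gs (IH _ _)).
Qed.

(** * Adjoining p-power roots *)

Section PerfectExponents.
Variables (p r n : nat).
Hypotheses (p0 : (0 < p)%N) (hrn : (r <= n)%N).

Section Level.
Variable m : nat.

(** The exponents with denominator [p ^ m]; the first [r] variables are the
    polynomial ones. *)
Definition scaled_exp (e : lexp r (n - r)) : {ffun 'I_n -> rat} :=
  [ffun i : 'I_n => (if insub (i : nat) is Some j then (e.1 j)%:R
     else if insub (i - r)%N is Some j then (e.2 j)%:~R else 0) / (p ^ m)%:R].

Let pm0 : (p ^ m)%:R != 0 :> rat.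
Proof. by rewrite pnatr_eq0 -lt0n expn_gt0 p0. Qed.

Lemma scaled_expP e : scaled_exp e \in @perf_exponent p r n.
Proof.
apply/asboolP; split.
  exists m => i; rewrite ffunE mulrCA mulfV // mulr1.
  case: insubP => [j _ _|_]; first exact: natr_int.
  by case: insubP => [j _ _|_]; [apply: intr_int|apply: rpred0].
by move=> i ir; rewrite ffunE insubT /= divr_ge0 ?ler0n.
Qed.

Definition level_exp (e : lexp r (n - r)) : perf_monom p r n :=
  PerfMonom (scaled_expP e).

Lemma level_exp0 : level_exp 0 = 0.
Proof.
apply: val_inj; apply/ffunP => i; rewrite !ffunE.
by case: insubP => [j _ _|_]; [|case: insubP => [j _ _|_]]; rewrite ?ffunE mul0r.
Qed.

Lemma level_expD a b : level_exp (a + b) = level_exp a + level_exp b.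
Proof.
apply: val_inj; apply/ffunP => i; rewrite !ffunE -mulrDl; congr (_ / _).
case: insubP => [j _ _|_]; first by rewrite ffunE natrD.
by case: insubP => [j _ _|_]; [rewrite ffunE intrD|rewrite addr0].
Qed.

Lemma level_exp_inj : injective level_exp.
Proof.
move=> [u v] [u' v'] /(congr1 val)/ffunP h.
have {}h i : scaled_exp (u, v) i = scaled_exp (u', v') i := h i.
congr pair; apply/ffunP => j.
  have := h (widen_ord hrn j); rewrite !ffunE /= valK.
  by move=> /(mulIf (invr_neq0 pm0)) /eqP; rewrite eqr_nat => /eqP.
have lt : (r + j < n)%N by rewrite -ltn_subRL.
have := h (Ordinal lt); rewrite !ffunE /= insubN -?leqNgt ?leq_addr // addKn valK.
by move=> /(mulIf (invr_neq0 pm0)) /eqP; rewrite eqr_int => /eqP.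
Qed.

Lemma level_exp_surj (e : perf_monom p r n) :
  (forall i, (p ^ m)%:R * pm_exp e i \is a Num.int) -> exists x, level_exp x = e.
Proof.
move=> he; have /choice[w hw] : forall i, exists z : int,
    (p ^ m)%:R * pm_exp e i = z%:~R.
  by move=> i; apply/intrP.
have lt (j : 'I_(n - r)) : (r + j < n)%N by rewrite -ltn_subRL.
exists ([ffun j => absz (w (widen_ord hrn j))], [ffun j => w (Ordinal (lt j))]).
apply: val_inj; apply/ffunP => i; rewrite ffunE /=.
apply: (mulfI pm0); rewrite mulrCA mulfV // mulr1.
case: insubP => [j jr ji|ir].
  rewrite ffunE; have -> : widen_ord hrn j = i by apply: val_inj.
  have [_ e0] := asboolP _ (pm_expP e).
  rewrite hw natr_absz ger0_norm // -(ler_int rat) -hw mulr_ge0 ?ler0n //.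
  exact: e0.
have ri : (r <= i)%N by rewrite leqNgt.
have jlt : (i - r < n - r)%N by rewrite ltn_sub2r // (leq_ltn_trans ri).
rewrite (insubT (fun j => j < n - r)%N jlt) /= ffunE hw; congr ((w _)%:~R).
by apply: val_inj; rewrite /= subnKC.
Qed.
End Level.

Section Algebra.
Variable k : fieldType.

Lemma perf_level :
  exists F : nat -> {rmorphism monoid_alg k (lexp r (n - r)) -> perf_poly k p r n},
    (forall m, injective (F m)) /\
    forall m c e, F m (ma_monom c e) = ma_monom c (level_exp m e).
Proof.
have /choice[F hF] : forall m,
    exists F : {rmorphism monoid_alg k (lexp r (n - r)) -> perf_poly k p r n},
    injective F /\ forall c e, F (ma_monom c e) = ma_monom c (level_exp m e).
  move=> m; have [F [FU Fi]] := @ma_map_exp k _ _ _ (level_exp0 m) (level_expD m).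
  by exists F; split=> //; apply/Fi/level_exp_inj.
by exists F; split=> m; case: (hF m).
Qed.

(** The entries of an idempotent involve finitely many exponents, which share a
    denominator [p ^ m]. *)
Theorem idem_free_perf : idem_free (perf_poly k p r n).
Proof.
have [F [Fi FU]] := perf_level.
have im x : exists m, forall m', (m <= m')%N -> exists y, F m' y = x.
  elim/ma_ind: x => [|x1 x2 [m1 h1] [m2 h2]|c e].
  - by exists 0%N => m' _; exists 0; rewrite rmorph0.
  - exists (maxn m1 m2) => m'; rewrite geq_max => /andP[/h1[y1 <-] /h2[y2 <-]].
    by exists (y1 + y2); rewrite rmorphD.
  - have [[m hm] _] := asboolP _ (pm_expP e); exists m => m' mm'.
    have [|x hx] := @level_exp_surj m' e.
      by move=> i; rewrite -(subnK mm') expnD natrM -mulrA rpredM ?natr_int.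
    by exists (ma_monom c x); rewrite FU hx.
move=> N e he.
have /choice[ms hms] : forall ij : 'I_N * 'I_N, exists m, forall m', (m <= m')%N ->
   exists y, F m' y = e ij.1 ij.2 by move=> ij; apply: im.
pose m := (\max_ij ms ij)%N.
have /choice[g hg] : forall ij : 'I_N * 'I_N, exists y, F m y = e ij.1 ij.2.
  by move=> ij; apply: (hms ij); apply: leq_bigmax.
have eE : map_mx (F m) (\matrix_(i, j) g (i, j)) = e.
  by apply/matrixP => i j; rewrite 2!mxE hg.
have [|s h] := @quillen_suslin_laurent r (n - r) k N (\matrix_(i, j) g (i, j)).
  by apply: (map_mx_inj' (Fi m)); rewrite map_mxM eE.
by exists s; have := mvn_map (F m) h; rewrite eE map_mx1.
Qed.
End Algebra.
End PerfectExponents.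

(** * Lifting along quotients and completions *)

Section Quotients.
Variables (A : comPzRingType) (a : A).

Lemma quot_pi_surj (y : quot_ring a) : exists x, quot_pi a x = y.
Proof. by exists (repr y); apply: reprK. Qed.

Lemma quot_pi_eq x y : quot_pi a x = quot_pi a y <-> exists c, x - y = a * c.
Proof.
split; first by move/eqP/quot_eqP.
by move=> h; apply/eqP/quot_eqP.
Qed.

Lemma quot_pi_mul x y : quot_pi a (x * y) = quot_pi a x * quot_pi a y.
Proof. exact: rmorphM. Qed.
Lemma quot_pi1 : quot_pi a 1 = 1.
Proof. exact: rmorph1. Qed.

Lemma quot_induced (S : comPzRingType) (f : {rmorphism A -> S}) : f a = 0 ->
  exists g : {rmorphism quot_ring a -> S}, forall x, g (quot_pi a x) = f x.
Proof.
move=> fa; pose g (y : quot_ring a) := f (repr y).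
have gE x : g (quot_pi a x) = f x.
  have [c hc] : exists c, repr (quot_pi a x) - x = a * c.
    by apply/quot_pi_eq; apply: reprK.
  by apply/eqP; rewrite -subr_eq0 -rmorphB hc rmorphM fa mul0r.
have gz : zmod_morphism g.
  move=> y z; have [y' <-] := quot_pi_surj y; have [z' <-] := quot_pi_surj z.
  by rewrite -rmorphB !gE rmorphB.
have gm : GRing.monoid_morphism g.
  split; first by rewrite -(rmorph1 (quot_pi a)) gE rmorph1.
  move=> y z; have [y' <-] := quot_pi_surj y; have [z' <-] := quot_pi_surj z.
  by rewrite -rmorphM !gE rmorphM.
pose gR : {rmorphism quot_ring a -> S} :=
  HB.pack g (GRing.isZmodMorphism.Build _ _ g gz)
    (GRing.isMonoidMorphism.Build _ _ g gm).
by exists gR.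
Qed.

Definition nilpotent_mod (x : A) : Prop := exists M b, x ^+ M = a * b.

Lemma nilpotent_modD x y : nilpotent_mod x -> nilpotent_mod y -> nilpotent_mod (x + y).
Proof.
move=> [m [b hb]] [n [c hc]]; exists (m + n)%N.
suff : forall i : 'I_(m + n).+1, exists d,
    x ^+ (m + n - i) * y ^+ i *+ 'C(m + n, i) = a * d.
  move=> /choice[d hd]; exists (\sum_i d i); rewrite exprDn mulr_sumr.
  by apply: eq_bigr => i _; apply: hd.
move=> i; have [ni|lt] := leqP n i.
  exists (x ^+ (m + n - i) * c * y ^+ (i - n) *+ 'C(m + n, i)).
  have -> : y ^+ i = a * c * y ^+ (i - n) by rewrite -hc -exprD subnKC.
  by rewrite mulrnAr !mulrA [_ * a]mulrC.
have mi : (m <= m + n - i)%N by rewrite -addnBA ?leq_addr // ltnW.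
exists (b * x ^+ (m + n - i - m) * y ^+ i *+ 'C(m + n, i)).
have -> : x ^+ (m + n - i) = a * b * x ^+ (m + n - i - m).
  by rewrite -hb -exprD subnKC.
by rewrite mulrnAr !mulrA.
Qed.

(** A finite geometric series. *)
Lemma nilpotent_mod_unit x : nilpotent_mod (1 - x) -> exists y b, x * y = 1 - a * b.
Proof.
move=> [m [b hb]]; exists (\sum_(i < m) (1 - x) ^+ i), b.
by rewrite -hb -[RHS]opprB subrX1 -mulNr opprB subKr.
Qed.
End Quotients.

Section MonoidAlgebraQuotient.
Variables (A : comPzRingType) (E : nmodType).

Lemma ma_nilpotent_mod (a : A) (x : monoid_alg A E) :
  (forall e, nilpotent_mod a (ma_coef e x)) -> nilpotent_mod (ma_const E a) x.
Proof.
move=> hx; rewrite [x]monalgE; elim/big_ind: _ => [|y z|e _].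
- by exists 1%N, 0; rewrite expr1 mulr0.
- exact: nilpotent_modD.
have [m [b hb]] := hx e; exists m, (ma_monom b (e *+ m)).
by rewrite /ma_const ma_monomM add0r -hb; apply: ma_monomX.
Qed.

Lemma ma_map_surj (B : comPzRingType) (g : {rmorphism A -> B})
  (F : {rmorphism monoid_alg A E -> monoid_alg B E}) :
  (forall c e, F (ma_monom c e) = ma_monom (g c) e) ->
  (forall y, exists x, g x = y) -> forall y, exists x, F x = y.
Proof.
move=> FU gs; elim/ma_ind => [|y1 y2 [z1 h1] [z2 h2]|c e].
- by exists 0; rewrite rmorph0.
- by exists (z1 + z2); rewrite rmorphD h1 h2.
- by have [c' <-] := gs c; exists (ma_monom c' e); rewrite FU.
Qed.

Lemma ma_unit_mod (B : comPzRingType) (g : {rmorphism A -> B})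
  (F : {rmorphism monoid_alg A E -> monoid_alg B E}) (a : A) :
  (forall x e, ma_coef e (F x) = g (ma_coef e x)) ->
  (forall c, g c = 0 -> nilpotent_mod a c) ->
  forall x, F x = 1 -> exists y b, x * y = 1 - ma_const E a * b.
Proof.
move=> FC gn x Fx; apply: nilpotent_mod_unit; apply: ma_nilpotent_mod => e; apply: gn.
by rewrite -FC rmorphB rmorph1 Fx subrr raddf0.
Qed.
End MonoidAlgebraQuotient.

Section Completion.
Variables (A S : comPzRingType) (a : A) (f : {rmorphism A -> S}).
Hypotheses (fa : f a = 0) (fs : forall y, exists x, f x = y).
Hypothesis funit : forall k x, f x = 1 -> exists y b, x * y = 1 - a ^+ k * b.

Definition adic_proj k (x : adic_completion a) : quot_ring (a ^+ k) := adic_val x k.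
Fact adic_proj_zmod k : zmod_morphism (adic_proj k). Proof. by []. Qed.
Fact adic_proj_monoid k : GRing.monoid_morphism (adic_proj k). Proof. by []. Qed.
HB.instance Definition _ k :=
  GRing.isZmodMorphism.Build _ _ (adic_proj k) (adic_proj_zmod k).
HB.instance Definition _ k :=
  GRing.isMonoidMorphism.Build _ _ (adic_proj k) (adic_proj_monoid k).

Lemma adic_ext (x y : adic_completion a) :
  (forall k, adic_proj k x = adic_proj k y) -> x = y.
Proof. by move=> h; apply: val_inj; apply: functional_extensionality_dep. Qed.

Lemma adic_build (b : forall k, quot_ring (a ^+ k)) :
  (forall k, exists c, quot_pi (a ^+ k) c = b k /\ quot_pi (a ^+ k.+1) c = b k.+1) ->
  exists x : adic_completion a, forall k, adic_proj k x = b k.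
Proof.
move=> h; have hb : (b : nat_prod _) \in @adic_compatible A a by apply/asboolP.
by exists (AdicCompletion hb).
Qed.

(** If [x] maps to 1, then each component of [x] is represented by an element over
    1, hence is invertible. Inverses are unique, so they are compatible and form
    an inverse of [x]. *)
Lemma idem_free_completion : idem_free S -> idem_free (adic_completion a).
Proof.
have fa1 : f (a ^+ 1) = 0 by rewrite expr1.
have [g gE] := quot_induced fa1.
pose phi : {rmorphism adic_completion a -> S} := g \o adic_proj 1.
have phiE k (x : adic_completion a) c :
    quot_pi (a ^+ k.+1) c = adic_proj k.+1 x -> f c = phi x.
  elim: k c => [|k IH] c hc; first by rewrite /= -hc gE.
  have /asboolP/(_ k.+1)[d [hd hd']] := adic_valP x.
  rewrite -(IH _ hd); have [u hu] : exists u, c - d = a ^+ k.+2 * u.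
    by apply/quot_pi_eq; rewrite hc.
  by apply/eqP; rewrite -subr_eq0 -rmorphB hu rmorphM rmorphXn fa expr0n mul0r.
apply: (idem_free_lift (f := phi)).
  move=> y; have [b hb] := fs y.
  have [|x hx] := @adic_build (fun k => quot_pi (a ^+ k) b).
    by move=> k; exists b.
  by exists x; rewrite -hb; apply/esym/(phiE 0%N); rewrite hx.
move=> x px.
have inv k : exists y, adic_proj k x * y = 1.
  have [c hc] := quot_pi_surj (adic_proj k x); rewrite -hc.
  (* The zeroth component lives in the zero ring [A / a ^ 0]. *)
  case: k c hc => [|k] c hc.
    exists 1; rewrite mulr1 -quot_pi1; apply/quot_pi_eq.
    by exists (c - 1); rewrite mul1r.
  have [|y [b hb]] := funit k.+1 (x := c); first by rewrite (phiE k x c hc).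
  exists (quot_pi _ y); rewrite -quot_pi_mul -quot_pi1; apply/quot_pi_eq.
  by exists (- b); rewrite hb addrC addKr mulrN.
have [y hy] : exists y : forall k, quot_ring (a ^+ k),
    forall k, adic_proj k x * y k = 1.
  have h k : {y | adic_proj k x * y = 1} by apply/cid/inv.
  by exists (fun k => sval (h k)) => k; case: (h k).
have [k|z hz] := @adic_build y.
  have [c hc] := quot_pi_surj (y k.+1); exists c; split=> //.
  have /asboolP/(_ k)[b [hb hb']] := adic_valP x.
  have [u hu] : exists u, b * c - 1 = a ^+ k.+1 * u.
    by apply/quot_pi_eq; rewrite quot_pi_mul quot_pi1 hc hb'; apply: hy.
  have h1 : adic_proj k x * quot_pi (a ^+ k) c = 1.
    rewrite /adic_proj -hb -quot_pi_mul -quot_pi1; apply/quot_pi_eq.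
    by exists (a * u); rewrite hu exprSr mulrA.
  by rewrite -[LHS]mul1r -(hy k) mulrAC h1 mul1r.
exists z; apply: adic_ext => k.
have -> : adic_proj k (x * z) = adic_proj k x * adic_proj k z by [].
by rewrite hz hy.
Qed.
End Completion.

(** * Valuation rings of rank one *)

Section ValuationRing.
Variables (RR : realType) (K : valuedField RR).

Lemma val_residue : exists (k : fieldType) (f : {rmorphism val_ring K -> k}),
  (forall y, exists x, f x = y) /\ forall x, f x = 0 <-> absv (vr_val x) < 1.
Proof.
have [||||k [f [fs f0]]] := @residue_field (val_ring K) (fun x => absv (vr_val x) < 1).
- by have /absv_eq0 -> := erefl (0 : K); rewrite ltr01.
- by move=> x y hx hy; apply: le_lt_trans (absvD _ _) _; rewrite gt_max hx hy.
- move=> a x hx; rewrite /= absvM; apply: le_lt_trans hx.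
  by rewrite ler_piMl ?absv_ge0 //; apply: (vr_valP a).
- by rewrite /= absv1 ltxx.
exists k, f; split=> // x; split; last exact: f0.
move=> fx0; rewrite lt_neqAle [X in _ && X](vr_valP x) andbT.
apply/eqP => x1; have x0 : vr_val x != 0.
  by apply/eqP => /absv_eq0; rewrite x1 => /eqP; rewrite oner_eq0.
have xV : absv (vr_val x)^-1 = 1.
  by have := absvM (vr_val x) (vr_val x)^-1; rewrite mulfV // absv1 x1 mul1r.
have xVP : (vr_val x)^-1 \in @val_integral RR K by rewrite unfold_in xV.
have e : x * ValRing xVP = 1 by apply: val_inj; rewrite /= mulfV.
by have /eqP := congr1 f e; rewrite rmorphM fx0 mul0r rmorph1 eq_sym oner_eq0.
Qed.

Lemma absvX (x : K) n : absv (x ^+ n) = absv x ^+ n.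
Proof. by elim: n => [|n IH]; rewrite ?absv1 // !exprS absvM IH. Qed.

(** Bernoulli's inequality for [x^-1]. *)
Lemma expr_small (x e : RR) : 0 <= x -> x < 1 -> 0 < e -> exists n, x ^+ n <= e.
Proof.
move=> x0 x1 e0; have [->|xn0] := eqVneq x 0; first by exists 1%N; rewrite expr1 ltW.
have xp : 0 < x by rewrite lt_neqAle eq_sym xn0.
have d0 : 0 < x^-1 - 1 by rewrite subr_gt0 invf_gt1.
pose d := x^-1 - 1; have xV : x^-1 = 1 + d by rewrite addrC subrK.
have bern n : 1 + n%:R * d <= (1 + d) ^+ n.
  elim: n => [|n IH]; first by rewrite mul0r addr0 expr0.
  rewrite exprS; apply: le_trans (_ : (1 + d) * (1 + n%:R * d) <= _).
    have := mulr_ge0 (ler0n RR n) (mulr_ge0 (ltW d0) (ltW d0)); rewrite -/d.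
    rewrite -natr1; nra.
  by rewrite ler_pM2l // -xV invr_gt0.
pose n := Num.bound ((e * d)^-1); exists n.
have ed : 0 < e * d by rewrite mulr_gt0.
have hn : (e * d)^-1 < n%:R by apply: archi_boundP; rewrite invr_ge0 ltW.
rewrite -lef_pV2 ?posrE ?exprn_gt0 // -exprVn xV; apply: le_trans (bern n).
move: hn; rewrite invfM ltr_pdivrMr // => hn.
by apply: ltW; apply: lt_le_trans hn _; rewrite lerDr ler01.
Qed.

(** Absolute values are real numbers, so the powers of [c] tend to zero. *)
Lemma val_nilpotent_mod (w c : val_ring K) k : vr_val w != 0 -> absv (vr_val c) < 1 ->
  nilpotent_mod (w ^+ k) c.
Proof.
move=> w0 c1; have wk0 : vr_val w ^+ k != 0 by rewrite expf_neq0.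
have wkp : 0 < absv (vr_val w ^+ k).
  by rewrite lt_neqAle absv_ge0 andbT eq_sym; apply/eqP => /absv_eq0/eqP; apply/negP.
have [n hn] := expr_small (absv_ge0 (vr_val c)) c1 wkp.
have bP : vr_val c ^+ n / vr_val w ^+ k \in @val_integral RR K.
  rewrite unfold_in -(ler_pM2r wkp) -absvM divfK // mul1r.
  by rewrite absvX.
exists n, (ValRing bP); apply: val_inj.
have valX (x : val_ring K) m : vr_val (x ^+ m) = vr_val x ^+ m.
  exact: (rmorphXn (val : val_ring K -> K)).
by rewrite /= !valX mulrCA mulfV ?mulr1.
Qed.

Lemma pseudouniformizer_lt1 (w : val_ring K) : pseudouniformizer (vr_val w) ->
  vr_val w != 0 /\ absv (vr_val w) < 1.
Proof.
move=> [wu wn]; rewrite -unitfE; split=> //.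
have [N /(_ N (leqnn N)) h] := wn 1 ltr01.
rewrite lt_neqAle [X in _ && X](vr_valP w) andbT; apply: contraTneq h => w1.
by rewrite absvX w1 expr1n ltxx.
Qed.
End ValuationRing.

Theorem corollary2p17 (RR : realType) (K : valuedField RR) (p : nat)
    (hK : perfectoid K p) (w : val_ring K) (hw : pseudouniformizer (vr_val w))
    (r n : nat) (hrn : (r <= n)%N) (d : nat) (hd : (0 < d)%N) :
  (forall M : lmodType (perf_tate_integral w p r n),
     finite_module M -> projective_module M -> free_module M) /\
  (forall M : lmodType (perf_poly_mod w d p r n),
     finite_module M -> projective_module M -> free_module M).
Proof.
have p0 : (0 < p)%N by case: hK => _ _ [/prime_gt0].
have [w0 w1] := pseudouniformizer_lt1 hw.
have [k [f [fs f0]]] := val_residue K.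
have free_k := @idem_free_perf p r n p0 hrn k.
have fw : f w = 0 by apply/f0.
have nil c j : f c = 0 -> nilpotent_mod (w ^+ j) c by move=> /f0; apply: val_nilpotent_mod.
split; apply: idem_free_module.
  have [F [FU FC]] := ma_map_coef (perf_monom p r n) f.
  apply: (@idem_free_completion _ _ _ F) free_k.
  - by rewrite /ma_const FU fw; apply: monalgU0.
  - exact: ma_map_surj FU fs.
  - move=> j x Fx; have [y [b h]] := ma_unit_mod FC (nil^~ j) Fx.
    by exists y, b; apply: etrans h _; congr (1 - _ * _); apply: rmorphXn.
have fwd : f (w ^+ d) = 0 by rewrite rmorphXn fw expr0n gtn_eqF.
have [g gE] := quot_induced fwd.
have [F [FU FC]] := ma_map_coef (perf_monom p r n) g.
apply: (idem_free_lift (f := F)) free_k.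
  apply: ma_map_surj FU _ => y; have [x <-] := fs y.
  by exists (quot_pi _ x); rewrite gE.
move=> x Fx; have [|y [b h]] := @ma_unit_mod _ _ _ g F 0 FC _ x Fx.
  move=> c; have [c' <-] := quot_pi_surj c; rewrite gE => /nil-/(_ d)[m [b hb]].
  exists m, 0; rewrite mulr0 -rmorphXn hb.
  rewrite -(rmorph0 (quot_pi (w ^+ d))); apply/quot_pi_eq; exists b.
  by rewrite subr0.
by exists y; rewrite h rmorph0 mul0r subr0.
Qed.
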